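(* With notation as in the context, for every $g\in\overline{\widetilde{\mathbb M}}$ (closure in $\mathbb G$), $$d(g)^2=\sup_{\tau\in\Omega_*}\phi(g;\tau).$$
   Context: Let $q,m\ge1$, $U^{(1)},\dots,U^{(m)}$ linearly independent real skew-symmetric $q\times q$ matrices; $\mathbb G=\mathbb R^q\times\mathbb R^m$ with law $(x,t)\cdot(x',t')=(x+x',t+t'+\frac12\langle\mathbb Ux,x'\rangle)$, $\langle\mathbb Ux,x'\rangle=(\langle U^{(j)}x,x'\rangle)_j$, identity $o$; $d(g)$ is the Carnot–Carathéodory distance from $o$ (infimum of $\int_0^1|x'|$ over absolutely continuous curves from $o$ to $g$ with $t'=\frac12\langle\mathbb Ux,x'\rangle$). $U(\tau)=i\sum_j\tau_jU^{(j)}$, $\Omega_*=\{\tau:\|U(\tau)\|<\pi\}$, $\phi((x,t);\tau)=\langle U(\tau)\cot U(\tau)x,x\rangle+4t\cdot\tau$. $\widetilde{\mathbb M}=\{g:\phi(g;\cdot)$ attains its maximum in $\Omega_*\}$. *)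

(* Defs.v *)
From HB Require Import structures.
From mathcomp Require Import all_boot all_order all_algebra.
From mathcomp Require Import all_classical all_reals all_analysis.
Set Implicit Arguments. Unset Strict Implicit. Unset Printing Implicit Defensive.
Import Order.TTheory GRing.Theory Num.Theory.
Import numFieldNormedType.Exports.
Local Open Scope classical_set_scope.
Local Open Scope ring_scope.

Section Defs.
Variable R : realType.

Definition dotv n (u v : 'cV[R]_n) : R := \sum_(i < n) u i 0 * v i 0.

Definition eucl n (u : 'cV[R]_n) : R := Num.sqrt (dotv u u).

Definition abs_cont (a b : R) (f : R -> R) : Prop :=
  forall e : R, 0 < e -> exists2 d : R, 0 < d &
    forall (n : nat) (l r : 'I_n -> R),
      (forall k, a <= l k /\ l k <= r k /\ r k <= b) ->
      (forall k k', k != k' -> r k <= l k' \/ r k' <= l k) ->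
      \sum_(k < n) (r k - l k) < d ->
      \sum_(k < n) `|f (r k) - f (l k)| < e.

Definition abs_cont_vec n (a b : R) (x : R -> 'cV[R]_n) : Prop :=
  forall i : 'I_n, abs_cont a b (fun s => x s i 0).

Definition dervec n (x : R -> 'cV[R]_n) (s : R) : 'cV[R]_n :=
  \col_(i < n) derive1 (fun u => x u i 0) s.

Definition derivable_vec n (x : R -> 'cV[R]_n) (s : R) : Prop :=
  forall i : 'I_n, derivable (fun u => x u i 0) s 1.

Variables (q m : nat) (U : 'I_m -> 'M[R]_q).

Definition Gpt := ('cV[R]_q * 'cV[R]_m)%type.

Definition Uform (x x' : 'cV[R]_q) : 'cV[R]_m :=
  \col_(j < m) dotv (U j *m x) x'.

Definition horizontal_curve (g : Gpt) (x : R -> 'cV[R]_q) (t : R -> 'cV[R]_m)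
  : Prop :=
  [/\ x 0 = 0, t 0 = 0, x 1 = g.1 & t 1 = g.2] /\
  [/\ abs_cont_vec 0 1 x, abs_cont_vec 0 1 t &
      {ae (@lebesgue_measure R), forall s, s \in `[(0:R), 1] ->
          [/\ derivable_vec x s, derivable_vec t s &
              dervec t s = 2^-1 *: Uform (x s) (dervec x s)]}].

Definition ccdist (g : Gpt) : \bar R :=
  ereal_inf [set l : \bar R | exists x t, horizontal_curve g x t /\
     l = (\int[@lebesgue_measure R]_(s in `[0%R, 1%R])
            (eucl (dervec x s))%:E)%E].

(* A(tau) = sum_j tau_j U^(j); then U(tau) = i A(tau). *)
Definition Amat (tau : 'cV[R]_m) : 'M[R]_q := \sum_(j < m) tau j 0 *: U j.

(* Operator norm (w.r.t. the Euclidean norm) of a real matrix.  For a real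
   matrix A, ||i A|| on C^q equals this real operator norm. *)
Definition opnorm (A : 'M[R]_q) : R :=
  sup [set eucl (A *m v) | v in [set v : 'cV[R]_q | eucl v <= 1]].

Definition Omega_star : set 'cV[R]_m := [set tau | opnorm (Amat tau) < pi].

(* Functional calculus for diagonalizable (e.g. real symmetric) matrices:
   f(S) is the matrix acting as f(lam) on every lam-eigenvector of S. *)
Definition matfun (f : R -> R) (S : 'M[R]_q) : 'M[R]_q :=
  xget 0 [set M : 'M[R]_q | forall (v : 'cV[R]_q) (lam : R),
                 S *m v = lam *: v -> M *m v = f lam *: v].

(* h(s) = sqrt s * cot (sqrt s), h(0) = 1, so that z cot z = h(z^2). *)
Definition hcot (s : R) : R :=
  if s == 0 then 1 else Num.sqrt s * cos (Num.sqrt s) / sin (Num.sqrt s).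

(* U(tau) cot U(tau) = h(U(tau)^2) = h(- A(tau)^2)  (a real symmetric matrix). *)
Definition UcotU (tau : 'cV[R]_m) : 'M[R]_q :=
  matfun hcot (- (Amat tau *m Amat tau)).

Definition phi (g : Gpt) (tau : 'cV[R]_m) : R :=
  dotv (UcotU tau *m g.1) g.1 + 4 * dotv g.2 tau.

Definition Mtilde : set Gpt :=
  [set g | exists2 tau0, Omega_star tau0 &
             forall tau, Omega_star tau -> phi g tau <= phi g tau0].

End Defs.

(* Main.v *)
Require Import Defs.
From HB Require Import structures.
From mathcomp Require Import all_boot all_order all_algebra.
From mathcomp.real_closed Require Import complex.
From mathcomp Require Import all_classical all_reals all_analysis.
From mathcomp Require Import measurable_realfun ring lra.
Set Implicit Arguments. Unset Strict Implicit. Unset Printing Implicit Defensive.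
Import Order.TTheory GRing.Theory Num.Theory.
Import numFieldNormedType.Exports.
Local Open Scope classical_set_scope.
Local Open Scope ring_scope.

(**
  Lower bound.  Let A = A(tau) with spectral projections P_i and frequencies
  nu_i < pi.  Along a horizontal curve of length function l, put L = l(1) + e
  and th = (l + e) / L.  The function
     H = sum_i nu_i cot(th nu_i) |P_i x|^2 + 4 tau.t - L l
  is absolutely continuous, and completing the square gives
  H' <= - (|x'| / L) (|w| - L)^2 <= 0 for a suitable vector w; hence
  phi(g; tau) <= L l(1), and phi(g; tau) <= d(g)^2 when e tends to 0.

  Upper bound.  The solution of x' = 2 A x + p, x(0) = 0, has constant speed
  |p|, and for p = (U cot U - A) X it ends at X, with
  |p|^2 = phi((X, T); tau), where T is its vertical endpoint.  By the lower
  bound, -4 T is then a supergradient at tau of the function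
  tau |-> <U cot U X, X>, which is therefore concave; as T depends
  continuously on tau, a maximizer tau of phi((X, t); .) satisfies T = t.  A
  point g of the closure is a limit of such endpoints, with (tau, p) in a
  bounded set, so it is the endpoint of a limiting geodesic.  Since tau may
  approach the boundary of Omega_*, the energy is compared at r tau, r < 1,
  using r phi(g; tau) <= phi(g; r tau).
*)

(** * Euclidean norm and operator norm *)

Section DotProduct.
Variable R : realType.

(** At a point of the closure, [phi g] need not attain its supremum in [Omega_star], and [UcotU]
    blows up at the boundary of that set. What survives the limit is the geodesic, described by
    (tau, p): tau stays bounded because the [U j] are linearly independent, p because |p|^2 = phi(g;
    tau) <= |X|^2 + 4 t.tau, and the equation x' = 2 A x + p depends continuously on (tau, p)
    without mentioning [UcotU]. Everything then rests on one inequality: |p|^2 <= S for every upper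
    bound S of [phi g]. Taking for S the supremum gives its value; taking for S the squared length
    of a competing curve, which the lower bound allows, gives minimality. Curves are only absolutely
    continuous, so H' <= 0 is known almost everywhere; H 1 <= H 0 is obtained by covering the
    exceptional null set, without integrating H'. Nor is phi ever differentiated in tau:
    supergradients at points near a maximizer replace the first-order condition. *)

Lemma dotvC n (u v : 'cV[R]_n) : dotv u v = dotv v u.
Proof. by apply: eq_bigr => i _; rewrite mulrC. Qed.

Lemma dotvDl n (u v w : 'cV[R]_n) : dotv (u + v) w = dotv u w + dotv v w.
Proof. by rewrite -big_split; apply: eq_bigr => i _; rewrite mxE mulrDl. Qed.

Lemma dotvZl n a (u v : 'cV[R]_n) : dotv (a *: u) v = a * dotv u v.
Proof. by rewrite mulr_sumr; apply: eq_bigr => i _; rewrite mxE mulrA. Qed.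

Lemma dotvDr n (u v w : 'cV[R]_n) : dotv u (v + w) = dotv u v + dotv u w.
Proof. by rewrite dotvC dotvDl !(dotvC _ u). Qed.

Lemma dotvZr n a (u v : 'cV[R]_n) : dotv u (a *: v) = a * dotv u v.
Proof. by rewrite dotvC dotvZl dotvC. Qed.

Lemma dotvNl n (u v : 'cV[R]_n) : dotv (- u) v = - dotv u v.
Proof. by rewrite -scaleN1r dotvZl mulN1r. Qed.

Lemma dotvNr n (u v : 'cV[R]_n) : dotv u (- v) = - dotv u v.
Proof. by rewrite dotvC dotvNl dotvC. Qed.

Lemma dotvBl n (u v w : 'cV[R]_n) : dotv (u - v) w = dotv u w - dotv v w.
Proof. by rewrite dotvDl dotvNl. Qed.

Lemma dotvBr n (u v w : 'cV[R]_n) : dotv u (v - w) = dotv u v - dotv u w.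
Proof. by rewrite dotvDr dotvNr. Qed.

Lemma dot0v n (u : 'cV[R]_n) : dotv 0 u = 0.
Proof. by rewrite -(scale0r 0) dotvZl mul0r. Qed.

Lemma dotv0 n (u : 'cV[R]_n) : dotv u 0 = 0.
Proof. by rewrite dotvC dot0v. Qed.

Lemma dotv_suml n I (r : seq I) (F : I -> 'cV[R]_n) v :
  dotv (\sum_(i <- r) F i) v = \sum_(i <- r) dotv (F i) v.
Proof.
elim: r => [|a r IH]; first by rewrite !big_nil dot0v.
by rewrite !big_cons dotvDl IH.
Qed.

Lemma dotv_trmx n p (A : 'M[R]_(n, p)) u v :
  dotv (A *m u) v = dotv u (A^T *m v).
Proof.
rewrite /dotv; under eq_bigr do rewrite mxE mulr_suml.
rewrite exchange_big; apply: eq_bigr => i _; rewrite mxE mulr_sumr.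
by apply: eq_bigr => j _; rewrite mxE; ring.
Qed.

Lemma dotv_skew n (A : 'M[R]_n) u v : A^T = - A ->
  dotv (A *m u) v = - dotv u (A *m v).
Proof. by move=> hA; rewrite dotv_trmx hA mulNmx dotvNr. Qed.

Lemma dotv_skew_self n (A : 'M[R]_n) u : A^T = - A -> dotv (A *m u) u = 0.
Proof. by move=> /dotv_skew hA; have := hA u u; rewrite (dotvC u); lra. Qed.

Lemma dotv_ge0 n (u : 'cV[R]_n) : 0 <= dotv u u.
Proof. by apply: sumr_ge0 => i _; rewrite -expr2 sqr_ge0. Qed.

Lemma dotv_eq0 n (u : 'cV[R]_n) : dotv u u = 0 -> u = 0.
Proof.
move=> /eqP; rewrite psumr_eq0 => [/allP h|i _]; last by rewrite -expr2 sqr_ge0.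
apply/matrixP => i j; rewrite (ord1 j) mxE.
by apply/eqP; have := h i (mem_index_enum _); rewrite mulf_eq0 orbb.
Qed.

Lemma eucl_ge0 n (u : 'cV[R]_n) : 0 <= eucl u.
Proof. exact: sqrtr_ge0. Qed.

Lemma sqr_eucl n (u : 'cV[R]_n) : eucl u ^+ 2 = dotv u u.
Proof. by rewrite sqr_sqrtr// dotv_ge0. Qed.

Lemma eucl0 n : eucl (0 : 'cV[R]_n) = 0.
Proof. by rewrite /eucl dot0v sqrtr0. Qed.

Lemma eucl_eq0 n (u : 'cV[R]_n) : eucl u = 0 -> u = 0.
Proof. by move=> h; apply: dotv_eq0; rewrite -sqr_eucl h expr0n. Qed.

Lemma euclZ n a (u : 'cV[R]_n) : eucl (a *: u) = `|a| * eucl u.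
Proof.
by rewrite /eucl dotvZl dotvZr mulrA -expr2 sqrtrM ?sqr_ge0// sqrtr_sqr.
Qed.

Lemma dotv_le n (u v : 'cV[R]_n) : dotv u v <= eucl u * eucl v.
Proof.
have [/eucl_eq0->|u0] := eqVneq (eucl u) 0; first by rewrite dot0v eucl0 mul0r.
have [/eucl_eq0->|v0] := eqVneq (eucl v) 0; first by rewrite dotv0 eucl0 mulr0.
have {}u0 : 0 < eucl u by rewrite lt_def u0 eucl_ge0.
have {}v0 : 0 < eucl v by rewrite lt_def v0 eucl_ge0.
have := dotv_ge0 (eucl v *: u - eucl u *: v).
rewrite !(dotvBl, dotvBr, dotvZl, dotvZr) -!sqr_eucl (dotvC v u) => h.
have := mulr_gt0 u0 v0; nra.
Qed.

Lemma normr_dotv_le n (u v : 'cV[R]_n) : `|dotv u v| <= eucl u * eucl v.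
Proof.
rewrite ler_norml dotv_le andbT lerNl -dotvNl (le_trans (dotv_le _ _))//.
by rewrite -scaleN1r euclZ normrN1 mul1r.
Qed.

Lemma eucl_le n (u : 'cV[R]_n) c : 0 <= c -> dotv u u <= c ^+ 2 -> eucl u <= c.
Proof. by move=> c0 h; rewrite -(ger0_norm c0) -sqrtr_sqr ler_wsqrtr. Qed.

Lemma euclD n (u v : 'cV[R]_n) : eucl (u + v) <= eucl u + eucl v.
Proof.
apply: eucl_le; first by rewrite addr_ge0 ?eucl_ge0.
rewrite dotvDl !dotvDr (dotvC v u) -!sqr_eucl.
have := dotv_le u v; nra.
Qed.

Lemma euclN n (u : 'cV[R]_n) : eucl (- u) = eucl u.
Proof. by rewrite -scaleN1r euclZ normrN1 mul1r. Qed.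

Lemma euclB n (u v : 'cV[R]_n) : eucl (u - v) <= eucl u + eucl v.
Proof. by rewrite -(euclN v) euclD. Qed.

Lemma coord_le_eucl n (u : 'cV[R]_n) i : `|u i 0| <= eucl u.
Proof.
rewrite -sqrtr_sqr ler_wsqrtr// /dotv (bigD1 i)//= -expr2 lerDl.
by apply: sumr_ge0 => j _; rewrite -expr2 sqr_ge0.
Qed.

Lemma eucl_le_sum n (u : 'cV[R]_n) : eucl u <= \sum_i `|u i 0|.
Proof.
apply: eucl_le; first exact: sumr_ge0.
rewrite expr2 mulr_suml; apply: ler_sum => i _.
have -> : u i 0 * u i 0 = `|u i 0| * `|u i 0| by rewrite -normrM ger0_norm// -expr2 sqr_ge0.
by rewrite ler_wpM2l// (bigD1 i)//= lerDl sumr_ge0.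
Qed.

(** The entrywise l^1 norm: a crude bound that makes the supremum in [opnorm] a genuine one and is
    easy to estimate on linear combinations of matrices. *)
Definition mnorm n p (M : 'M[R]_(n, p)) : R := \sum_i \sum_j `|M i j|.

Lemma mnorm_ge0 n p (M : 'M[R]_(n, p)) : 0 <= mnorm M.
Proof. by apply: sumr_ge0 => i _; apply: sumr_ge0. Qed.

Lemma eucl_mulmx n p (M : 'M[R]_(n, p)) v : eucl (M *m v) <= mnorm M * eucl v.
Proof.
apply: (le_trans (eucl_le_sum _)); rewrite mulr_suml; apply: ler_sum => i _.
rewrite mxE (le_trans (ler_norm_sum _ _ _))// mulr_suml; apply: ler_sum => j _.
by rewrite normrM ler_wpM2l// coord_le_eucl.
Qed.

Lemma mnormD n p (M N : 'M[R]_(n, p)) : mnorm (M + N) <= mnorm M + mnorm N.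
Proof.
rewrite -big_split; apply: ler_sum => i _; rewrite -big_split.
by apply: ler_sum => j _; rewrite mxE ler_normD.
Qed.

Lemma mnormZ n p a (M : 'M[R]_(n, p)) : mnorm (a *: M) = `|a| * mnorm M.
Proof.
rewrite mulr_sumr; apply: eq_bigr => i _; rewrite mulr_sumr.
by apply: eq_bigr => j _; rewrite mxE normrM.
Qed.

Lemma mnorm0 n p : mnorm (0 : 'M[R]_(n, p)) = 0.
Proof. by rewrite /mnorm big1// => i _; rewrite big1// => j _; rewrite mxE normr0. Qed.

Lemma mnorm_sum n p I (r : seq I) (F : I -> 'M[R]_(n, p)) :
  mnorm (\sum_(i <- r) F i) <= \sum_(i <- r) mnorm (F i).
Proof.
elim: r => [|a r IH]; first by rewrite !big_nil mnorm0.
by rewrite !big_cons (le_trans (mnormD _ _))// lerD2l.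
Qed.

End DotProduct.

Section OperatorNorm.
Variables (R : realType) (n : nat).
Implicit Types (A B : 'M[R]_n) (v : 'cV[R]_n).

Lemma eucl_le_opnorm A v : eucl (A *m v) <= opnorm A * eucl v.
Proof.
have [/eucl_eq0->|v0] := eqVneq (eucl v) 0; first by rewrite mulmx0 !eucl0 mulr0.
have {}v0 : 0 < eucl v by rewrite lt_def v0 eucl_ge0.
rewrite -ler_pdivrMr//.
have -> : eucl (A *m v) / eucl v = eucl (A *m ((eucl v)^-1 *: v)).
  by rewrite -scalemxAr euclZ ger0_norm ?invr_ge0 ?eucl_ge0// mulrC.
apply: ub_le_sup.
  exists (mnorm A) => _ [w /= w1 <-]; rewrite (le_trans (eucl_mulmx _ _))//.
  by rewrite ler_piMr ?mnorm_ge0.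
exists ((eucl v)^-1 *: v) => //=.
by rewrite euclZ ger0_norm ?invr_ge0 ?eucl_ge0// mulVf ?gt_eqF.
Qed.

Lemma opnorm_le A c : 0 <= c -> (forall v, eucl (A *m v) <= c * eucl v) ->
  opnorm A <= c.
Proof.
move=> c0 h; apply: sup_le_ub; first by exists (eucl (A *m 0)), 0; rewrite //= eucl0.
by move=> _ [v /= v1 <-]; rewrite (le_trans (h v))// ler_piMr.
Qed.

Lemma opnorm_ge0 A : 0 <= opnorm A.
Proof.
apply: ub_le_sup; last by exists 0; rewrite /= ?mulmx0 eucl0.
exists (mnorm A) => _ [w /= w1 <-]; rewrite (le_trans (eucl_mulmx _ _))//.
by rewrite ler_piMr ?mnorm_ge0.
Qed.

Lemma opnormD A B : opnorm (A + B) <= opnorm A + opnorm B.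
Proof.
apply: opnorm_le => [|v]; first by rewrite addr_ge0 ?opnorm_ge0.
by rewrite mulmxDl mulrDl (le_trans (euclD _ _))// lerD ?eucl_le_opnorm.
Qed.

Lemma opnormZ_le a A : opnorm (a *: A) <= `|a| * opnorm A.
Proof.
apply: opnorm_le => [|v]; first by rewrite mulr_ge0 ?opnorm_ge0.
by rewrite -scalemxAl euclZ -mulrA ler_wpM2l// eucl_le_opnorm.
Qed.

Lemma opnorm_le_mnorm A : opnorm A <= mnorm A.
Proof. by apply: opnorm_le; [exact: mnorm_ge0|exact: eucl_mulmx]. Qed.

Lemma entry_le_opnorm A i j : `|A i j| <= opnorm A.
Proof.
have e1 : eucl (delta_mx j 0 : 'cV[R]_n) = 1.
  rewrite /eucl /dotv (bigD1 j)//= big1 ?mxE ?eqxx ?addr0 ?mulr1 ?sqrtr1// => k kj.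
  by rewrite mxE (negPf kj) mul0r.
rewrite -[leRHS]mulr1 -e1; apply: le_trans (eucl_le_opnorm _ _).
by rewrite -colE (le_trans _ (coord_le_eucl _ i))// mxE.
Qed.

End OperatorNorm.

(** * Spectral resolution of skew-symmetric matrices *)

Section SpectralResolution.
Variables (R : realType) (n : nat).
Implicit Types (A S : 'M[R]_n).

(** Over [C] the image of [S] is hermitian, hence unitarily diagonalizable with real spectrum. Of
    this only a polynomial identity with distinct real roots is kept, because it descends along the
    injection [iota], which the diagonalizing matrix need not do. *)
Lemma sym_annihilated_in (C : numClosedFieldType) (iota : {rmorphism R -> C}) S :
  (forall a, iota a \is Num.real) ->
  (forall z, z \is Num.real -> exists a, z = iota a) -> S^T = S ->
  exists2 s : seq R, uniq s & \prod_(k <- s) (S - k%:M) = 0.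
Proof.
move=> iotaR Riota symS; pose Sc : 'M[C]_n := map_mx iota S.
have hSc : Sc \is hermsymmx.
  apply: realsym_hermsym; last by apply/mxOverP => i j; rewrite mxE.
  by apply/is_hermitianmxP; rewrite expr0 scale1r map_mx_id// /Sc map_trmx symS.
have Sc_eq := orthomx_spectralP (hermitian_normalmx hSc).
have Pu := spectral_unit Sc.
have dR := hermitian_spectral_diag_real hSc.
set P := spectralmx Sc in Sc_eq Pu; set d := spectral_diag Sc in Sc_eq dR.
have /boolp.choice[e dE] : forall i, exists a, d 0 i = iota a.
  by move=> i; exact/Riota/(mxOverP dR).
(* Repeated eigenvalues are listed once, so that the annihilating polynomial has simple roots. *)
pose s := undup [seq e i | i : 'I_n].
exists s; first exact: undup_uniq.
have key (r : seq R) : P *m map_mx iota (\prod_(k <- r) (S - k%:M)) =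
    diag_mx (\row_i \prod_(k <- r) (d 0 i - iota k)) *m P.
  elim: r => [|k r IH].
    rewrite big_nil map_mx1 mulmx1; under eq_mx do rewrite big_nil.
    rewrite (_ : diag_mx _ = 1%:M) ?mul1mx//; apply/matrixP => i j.
    by rewrite !mxE.
  rewrite big_cons map_mxM mulmxA map_mxB map_scalar_mx mulmxBr -/Sc Sc_eq.
  rewrite !mulmxA mulmxV// mul1mx scalar_mxC -mulmxBl -mulmxA IH mulmxA.
  congr (_ *m P); apply/matrixP => i j.
  rewrite -diag_const_mx -linearB /= mul_diag_mx !mxE big_cons.
  by rewrite -mulrnAr.
apply/(map_mx_inj (f := iota)); rewrite map_mx0.
rewrite -[LHS]mul1mx -(mulVmx Pu) -mulmxA key.
rewrite (_ : diag_mx _ = 0) ?mul0mx ?mulmx0//.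
apply/matrixP => i j; rewrite !mxE.
have /(big_rem (e i)) -> : e i \in s by rewrite mem_undup; exact: map_f (mem_enum _ _).
by rewrite /= -dE subrr mul0r mul0rn.
Qed.

Lemma sym_annihilated S : S^T = S ->
  exists2 s : seq R, uniq s & \prod_(k <- s) (S - k%:M) = 0.
Proof.
apply: (@sym_annihilated_in (complex R) (@real_complex_def R (Phant R))) => [a|z].
  by apply/complex_realP; exists a.
by move/complex_realP.
Qed.

(** The kernel lemma by induction on the roots: the components of (S - a) V, divided by k - a, are
    those of V for k <> a, and the remainder is killed by S - a. Taking V = 1 produces the spectral
    projections. *)
Lemma eigen_decomposition S (s : seq R) p (V : 'M[R]_(n, p)) : uniq s ->
  (\prod_(k <- s) (S - k%:M)) *m V = 0 ->
  exists2 P : R -> 'M[R]_(n, p), \sum_(k <- s) P k = V &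
     {in s, forall k, S *m P k = k *: P k}.
Proof.
elim: s V => [|a s IH] V /=.
  by rewrite big_nil mul1mx => _ ->; exists (fun=> 0); rewrite ?big_nil.
move=> /andP[as_ us]; rewrite big_cons => h.
have comm : (\prod_(k <- s) (S - k%:M)) *m (S - a%:M) =
    (S - a%:M) *m \prod_(k <- s) (S - k%:M).
  elim: (s) => [|k r IHr]; first by rewrite big_nil mul1mx mulmx1.
  rewrite big_cons -[LHS]mulmxA IHr !mulmxA; congr (_ *m _).
  rewrite !mulmxBl !mulmxBr !mul_mx_scalar !mul_scalar_mx !scale_scalar_mx (mulrC k).
  by move: (S *m S) (a * k)%:M => T c; apply/matrixP => x y; rewrite !mxE; ring.
have [|P sumP eigP] := IH ((S - a%:M) *m V) us; first by rewrite mulmxA comm.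
pose Q k := (k - a)^-1 *: P k.
have ka k : k \in s -> k - a != 0.
  by move=> ks; rewrite subr_eq0; apply: contraNneq as_ => <-.
have eqQ k : k \in s -> S *m Q k = k *: Q k.
  by move=> ks; rewrite -scalemxAr eigP// !scalerA mulrC.
exists (fun k => if k == a then V - \sum_(k <- s) Q k else Q k).
  rewrite big_cons eqxx [X in _ + X](_ : _ = \sum_(k <- s) Q k) ?subrK//.
  apply: eq_big_seq => k ks.
  by rewrite -subr_eq0 (negPf (ka _ ks)).
move=> k; rewrite inE; case: eqVneq => [-> _|ka' /= ks]; last exact: eqQ.
rewrite -mul_scalar_mx; apply/eqP; rewrite -subr_eq0 -mulmxBl mulmxBr subr_eq0 -sumP.
rewrite mulmx_sumr big_seq [X in _ == X]big_seq; apply/eqP/eq_bigr => j js.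
by rewrite mulmxBl eqQ// mul_scalar_mx -scalerBl scalerA mulfV ?ka ?scale1r.
Qed.

(** The eigenvalues of iA are the numbers +mu i and -mu i. Each [P i] projects onto both eigenspaces
    together, that is onto an eigenspace of -A^2, and is therefore real and commutes with A. The
    last field evaluates the choice-based [matfun]. *)
Record skew_spectrum A N (mu : 'I_N -> R) (P : 'I_N -> 'M[R]_n) : Prop :=
  SkewSpectrum {
    sp_mu : forall i, 0 <= mu i <= opnorm A;
    sp_sum : \sum_i P i = 1%:M;
    sp_sym : forall i, (P i)^T = P i;
    sp_idem : forall i, P i *m P i = P i;
    sp_orth : forall i j, i != j -> P i *m P j = 0;
    sp_comm : forall i, A *m P i = P i *m A;
    sp_sqr : forall i, A *m (A *m P i) = - (mu i) ^+ 2 *: P i;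
    sp_matfun : forall f : R -> R,
      matfun f (- (A *m A)) = \sum_i f (mu i ^+ 2) *: P i }.

Lemma skew_spectrumP A : A^T = - A ->
  exists N (mu : 'I_N -> R) (P : 'I_N -> 'M[R]_n), skew_spectrum A mu P.
Proof.
move=> skA; pose S := - (A *m A).
have symS : S^T = S by rewrite /S linearN /= trmx_mul skA mulNmx mulmxN opprK.
have [s us hs] := sym_annihilated symS.
have [|P0 sumP0 eigP0] := @eigen_decomposition S s _ 1%:M us; first by rewrite hs mul0mx.
(* Dropping the zero components leaves only true eigenvalues, which are then bounded by testing A on
   an eigenvector. *)
pose t := [seq k <- s | P0 k != 0].
have ut : uniq t by rewrite filter_uniq.
have sumt : \sum_(k <- t) P0 k = 1%:M.
  by rewrite -sumP0 big_filter big_mkcond; apply: eq_bigr => k _; case: eqVneq.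
pose lam (i : 'I_(size t)) := tnth (in_tuple t) i.
have lamt i : lam i \in t by exact: mem_tnth.
have lam_inj i j : i != j -> lam i != lam j.
  apply: contra_neq; rewrite /lam !(tnth_nth 0) => /uniqP h.
  by apply/val_inj/h; rewrite ?inE ?ltn_ord.
pose P i := P0 (lam i).
have sumP : \sum_i P i = 1%:M by rewrite -sumt [RHS]big_tnth.
have eigP i : S *m P i = lam i *: P i.
  by apply: eigP0; have := lamt i; rewrite mem_filter => /andP[].
have P_neq0 i : P i != 0 by have := lamt i; rewrite mem_filter => /andP[].
(* Different eigenvalues of a symmetric matrix: B = 1 yields orthogonality and the symmetry of
   [P i], general B its commutation with everything that commutes with S. *)
have cross (B : 'M[R]_n) i j : B *m S = S *m B -> i != j -> (P i)^T *m B *m P j = 0.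
  move=> BS ij; have : (lam j - lam i) *: ((P i)^T *m B *m P j) = 0.
    rewrite scalerBl scalemxAr -eigP !scalemxAl -linearZ /= -eigP trmx_mul symS.
    by rewrite -!mulmxA (mulmxA B) BS -!mulmxA subrr.
  by move/eqP; rewrite scaler_eq0 subr_eq0 eq_sym (negPf (lam_inj _ _ ij)) => /eqP.
have PTP i : (P i)^T = (P i)^T *m P i.
  rewrite -[LHS]mulmx1 -sumP mulmx_sumr (bigD1 i)//= big1 ?addr0// => j ji.
  by rewrite -[in LHS](mulmx1 (P i)^T) cross ?mulmx1 ?mul1mx// eq_sym.
have Psym i : (P i)^T = P i by rewrite -[RHS]trmxK [in RHS]PTP trmx_mul trmxK -PTP.
have Pcomm (B : 'M[R]_n) i : B *m S = S *m B -> B *m P i = P i *m B.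
  move=> BS; transitivity (P i *m B *m P i).
    rewrite -[LHS]mul1mx -sumP mulmx_suml (bigD1 i)//= big1 ?addr0 ?mulmxA// => j ji.
    by rewrite mulmxA -Psym cross.
  rewrite -[RHS]mulmx1 -sumP mulmx_sumr (bigD1 i)//= big1 ?addr0// => j ji.
  by rewrite -[in LHS]Psym cross// eq_sym.
have AS : A *m S = S *m A by rewrite /S mulmxN mulNmx mulmxA.
have /boolp.choice[v vP] : forall i, exists v : 'cV[R]_n, P i *m v != 0.
  move=> i.
  have /eqP := P_neq0 i; apply: contra_notP => /forallNP h.
  apply/matrixP => a b; have /negP/negPn/eqP := h (delta_mx b 0).
  by move/matrixP => /(_ a 0); rewrite -colE !mxE.
have normA i (w := P i *m v i) : eucl (A *m w) ^+ 2 = lam i * eucl w ^+ 2.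
  by rewrite !sqr_eucl dotv_skew// mulmxA -dotvNr -mulNmx mulmxA eigP -scalemxAl dotvZr.
have lam_ge0 i : 0 <= lam i.
  have w0 : 0 < eucl (P i *m v i) ^+ 2.
    rewrite exprn_gt0// lt_def eucl_ge0 andbT.
    by apply: contra_neq (vP i) => /eucl_eq0.
  by rewrite -(pmulr_lge0 _ w0) -normA sqr_ge0.
have musq i : Num.sqrt (lam i) ^+ 2 = lam i by rewrite sqr_sqrtr.
exists (size t), (fun i => Num.sqrt (lam i)), P; split => //.
- move=> i; rewrite sqrtr_ge0 /=.
  have w0 : 0 < eucl (P i *m v i).
    rewrite lt_def eucl_ge0 andbT; by apply: contra_neq (vP i) => /eucl_eq0.
  rewrite -(ler_pM2r w0); apply: le_trans (eucl_le_opnorm _ _).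
  rewrite -(ler_pXn2r (n := 2)) ?nnegrE ?mulr_ge0 ?sqrtr_ge0 ?eucl_ge0//.
  by rewrite exprMn musq normA.
- by move=> i; rewrite -{1}Psym -PTP.
- by move=> i j ij; rewrite -{1}Psym -[(P i)^T]mulmx1 cross// ?mul1mx ?mulmx1.
- by move=> i; rewrite Pcomm.
- by move=> i; rewrite musq mulmxA -[A *m A]opprK mulNmx eigP scaleNr.
move=> f.
(* The explicit sum shows that the set defining [matfun] is inhabited. Any member of it is
   determined on the columns of each [P i], which are eigenvectors, and these columns span the
   space. *)
have hM : [set M : 'M[R]_n | forall (v : 'cV[R]_n) (l : R),
    S *m v = l *: v -> M *m v = f l *: v] (matfun f S).
  rewrite /matfun; apply: xgetPex; exists (\sum_i f (lam i) *: P i) => /= w l Sw.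
  rewrite -[w in RHS]mul1mx -sumP !mulmx_suml scaler_sumr; apply: eq_bigr => i _.
  have : (lam i - l) *: (P i *m w) = 0.
    by rewrite scalerBl scalemxAl -eigP Pcomm// -mulmxA Sw -scalemxAr subrr.
  move/eqP; rewrite scaler_eq0 subr_eq0 -scalemxAl => /orP[/eqP->//|/eqP->].
  by rewrite !scaler0.
rewrite -[LHS]mulmx1 -sumP mulmx_sumr; apply: eq_bigr => i _; rewrite musq.
apply/matrixP => a b; have := hM (col b (P i)) (lam i).
rewrite !colE !mulmxA eigP -scalemxAl => /(_ erefl).
by rewrite scalemxAl -!colE => /matrixP/(_ a 0); rewrite !mxE.
Qed.

End SpectralResolution.

(** * Absolutely continuous functions *)

Section AbsoluteContinuity.
Variable R : realType.
Implicit Types f g h : R -> R.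

(** Sums, multiples, products and Lipschitz images of absolutely continuous functions are all
    instances of this domination of increments. *)
Lemma abs_cont_dom a b f g h C : 0 <= C ->
  (forall s s', a <= s <= b -> a <= s' <= b ->
     `|h s - h s'| <= C * (`|f s - f s'| + `|g s - g s'|)) ->
  abs_cont a b f -> abs_cont a b g -> abs_cont a b h.
Proof.
move=> C0 hC acf acg e e0.
have C1 : 0 < 2 * (C + 1) by lra.
have e' : 0 < e / (2 * (C + 1)) by rewrite divr_gt0.
have [d1 d10 h1] := acf _ e'; have [d2 d20 h2] := acg _ e'.
exists (Num.min d1 d2); first by rewrite lt_min d10.
move=> n l r lr dis; rewrite lt_min => /andP[/(h1 n l r lr dis) {}h1 /(h2 n l r lr dis) {}h2].
apply: (@le_lt_trans _ _ (C * (\sum_k `|f (r k) - f (l k)| + \sum_k `|g (r k) - g (l k)|))).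
  rewrite -big_split mulr_sumr; apply: ler_sum => k _; have [al [lk rb]] := lr k.
  by apply: hC; rewrite ?rb ?al ?(le_trans al)// (le_trans lk).
apply: (@le_lt_trans _ _ ((C + 1) * (\sum_k `|f (r k) - f (l k)| + \sum_k `|g (r k) - g (l k)|))).
  by rewrite ler_wpM2r ?addr_ge0 ?sumr_ge0//; lra.
have -> : e = (C + 1) * (e / (2 * (C + 1)) + e / (2 * (C + 1))) by field; lra.
by rewrite ltr_pM2l ?ltrD//; lra.
Qed.

Lemma abs_contD a b f g : abs_cont a b f -> abs_cont a b g ->
  abs_cont a b (fun s => f s + g s).
Proof.
move=> af ag; apply: (abs_cont_dom (C := 1) _ _ af ag) => // s s' _ _.
by rewrite mul1r opprD addrACA ler_normD.
Qed.

Lemma abs_cont_cst a b c : abs_cont a b (fun=> c : R).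
Proof.
move=> e e0; exists 1 => // n l r _ _ _.
by rewrite big1// => k _; rewrite subrr normr0.
Qed.

Lemma abs_contZ a b c f : abs_cont a b f -> abs_cont a b (fun s => c * f s).
Proof.
move=> af; apply: (abs_cont_dom (C := `|c|) _ _ af af) => // s s' _ _.
by rewrite -mulrBr normrM ler_wpM2l// lerDl.
Qed.

Lemma abs_cont_sum a b I (r : seq I) (F : I -> R -> R) :
  (forall i, abs_cont a b (F i)) -> abs_cont a b (fun s => \sum_(i <- r) F i s).
Proof.
move=> acF; elim: r => [|i r IH].
  by under [fun s => _]eq_fun do rewrite big_nil; exact: abs_cont_cst.
under [fun s => _]eq_fun do rewrite big_cons.
exact: (abs_contD (acF i) IH).
Qed.

Lemma abs_cont_unif a b f : abs_cont a b f -> forall e, 0 < e ->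
  exists2 d, 0 < d & forall s s', a <= s -> s <= s' -> s' <= b -> s' - s < d ->
    `|f s' - f s| < e.
Proof.
move=> af e e0; have [d d0 h] := af e e0; exists d => // s s' as_ ss sb sd.
have := h 1%N (fun=> s) (fun=> s'); rewrite !big_ord1; apply => // k k'.
by rewrite !ord1 eqxx.
Qed.

Lemma abs_cont_bounded f : abs_cont 0 1 f ->
  exists M, forall s, 0 <= s <= 1 -> `|f s| <= M.
Proof.
move=> /abs_cont_unif/(_ 1 ltr01)[d d0 h].
(* Walking from 0 in steps of length d / 2, each of which changes f by less than 1. *)
have key k : forall s, 0 <= s <= 1 -> s <= k%:R * (d / 2) -> `|f s - f 0| <= k%:R.
  elim: k => [s s01|k IH s s01 sk].
    rewrite mul0r => s0; have -> : s = 0 by apply/eqP; rewrite eq_le s0; case/andP: s01.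
    by rewrite subrr normr0.
  have [sd|ds] := leP s (d / 2).
    have := h 0 s; have : 1 <= k.+1%:R :> R by rewrite ler1n.
    move: s01 => /andP[s0 s1] k1 /(_ (lexx _) s0 s1) hh; apply/ltW/(lt_le_trans _ k1)/hh; lra.
  have hs : `|f s - f (s - d / 2)| < 1 by apply: h; lra.
  have : `|f (s - d / 2) - f 0| <= k%:R.
    by apply: IH; [lra|move: sk; rewrite -natr1; lra].
  have := ler_normD (f s - f (s - d / 2)) (f (s - d / 2) - f 0).
  by rewrite addrA subrK -natr1; lra.
have [n nd] : exists n : nat, 1 <= n%:R * (d / 2).
  exists (Num.bound (d / 2)^-1); rewrite -ler_pdivrMr; last lra.
  by rewrite div1r ltW// archi_boundP// invr_ge0; lra.
exists (`|f 0| + n%:R) => s s01; have : `|f s - f 0| <= n%:R by apply: key; lra.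
by have := ler_normD (f s - f 0) (f 0); rewrite subrK; lra.
Qed.

Lemma abs_contM f g : abs_cont 0 1 f -> abs_cont 0 1 g ->
  abs_cont 0 1 (fun s => f s * g s).
Proof.
move=> af ag; have [M hM] := abs_cont_bounded af; have [K hK] := abs_cont_bounded ag.
have M0 : 0 <= M by apply: le_trans (hM 0 _); rewrite ?normr_ge0// lexx ler01.
have K0 : 0 <= K by apply: le_trans (hK 0 _); rewrite ?normr_ge0// lexx ler01.
apply: (abs_cont_dom (C := M + K) _ _ af ag) => [|s s' s01 s'01]; first lra.
have -> : f s * g s - f s' * g s' = f s * (g s - g s') + g s' * (f s - f s') by ring.
apply: (le_trans (ler_normD _ _)); rewrite !normrM.
have h1 := ler_wpM2r (normr_ge0 (g s - g s')) (hM _ s01).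
have h2 := ler_wpM2r (normr_ge0 (f s - f s')) (hK _ s'01).
have := normr_ge0 (g s - g s'); have := normr_ge0 (f s - f s'); nra.
Qed.

Lemma lipschitz_abs_cont a b f C : 0 <= C ->
  (forall s s', a <= s <= b -> a <= s' <= b -> `|f s - f s'| <= C * `|s - s'|) ->
  abs_cont a b f.
Proof.
move=> C0 h; have acid : abs_cont a b id.
  move=> e e0; exists e => // n l r lr _; under [X in _ -> X < _]eq_bigr => k _ do
    rewrite ger0_norm ?subr_ge0 ?(lr k).2.1//.
  by [].
apply: (abs_cont_dom C0 _ acid acid) => s s' hs hs'.
by rewrite (le_trans (h _ _ hs hs'))// ler_wpM2l// lerDl.
Qed.

(** A supremum argument. The local hypothesis compares points on both sides of c, so it carries the
    inequality across the supremum even when G is discontinuous there; G will contain a variation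
    term of unknown continuity. *)
Lemma locally_nonincreasing (G : R -> R) :
  (forall c, 0 <= c <= 1 -> exists2 d, 0 < d & forall a b,
     0 <= a -> b <= 1 -> c - d < a <= c -> c <= b < c + d -> G b <= G a) ->
  G 1 <= G 0.
Proof.
move=> h; pose E := [set s | 0 <= s <= 1 /\ G s <= G 0].
have E0 : E 0 by split; rewrite ?lexx ?ler01.
have ubE : ubound E 1 by move=> s [/andP[]].
have supE : has_sup E by split; [exists 0|exists 1].
pose c := sup E.
have c0 : 0 <= c by apply: ub_le_sup => //; exists 1.
have c1 : c <= 1 by apply: sup_le_ub => //; exists 0.
have [|d d0 hd] := h c; first by rewrite c0.
have [a [/andP[a0 a1] Ga] ca] : exists2 a, E a & c - d < a by exact: sup_adherent.
have ac : a <= c by apply: ub_le_sup; [exists 1|split; rewrite ?a0].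
pose b := Num.min 1 (c + d / 2).
have cb : c <= b by rewrite le_min c1; lra.
have bd : b < c + d by rewrite gt_min; apply/orP; right; lra.
have b1 : b <= 1 by rewrite ge_min lexx.
have Gb : G b <= G 0 by apply: le_trans Ga; apply: hd; rewrite ?ca ?ac ?cb ?bd.
have : b <= c by apply: ub_le_sup; [exists 1|split => //; rewrite b1 (le_trans c0)].
move: Gb; rewrite /b minEle; case: ifP => // _ _; lra.
Qed.

(** The straddle lemma: adding the one-sided quotient estimates at c handles all a <= c <= b at
    once, using the derivative at the single point c. *)
Lemma derive_le_slope f c e : derivable f c 1 -> derive1 f c <= 0 -> 0 < e ->
  exists2 d, 0 < d & forall a b, c - d < a <= c -> c <= b < c + d ->
    f b - f a <= e * (b - a).
Proof.
move=> df f0 e0.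
have := df => /cvg_ex[l hl].
have lE : l <= 0.
  move: f0; rewrite derive1E /derive (cvg_lim _ hl)//; exact: Rhausdorff.
move/cvgrPdist_lt : hl => /(_ e e0).
move=> [d /= d0 hd]; exists d => // a b ha hb.
have key x : `|x - c| < d -> x != c -> `|l - (x - c)^-1 * (f x - f c)| < e.
  move=> xd xc; have := hd (x - c); rewrite /= sub0r normrN => /(_ xd).
  by rewrite subr_eq0 => /(_ xc); rewrite /GRing.scale /= mulr1 subrK.
have right_ : f b - f c <= e * (b - c).
  have [->|bc] := eqVneq b c; first by rewrite !subrr mulr0.
  have bc0 : 0 < b - c by rewrite subr_gt0 lt_def bc; lra.
  have := key b; rewrite ger0_norm; last lra.
  move=> /(_ _ bc) hh; have {hh} : `|l - (b - c)^-1 * (f b - f c)| < e by apply: hh; lra.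
  rewrite ltr_norml => /andP[hh _].
  have : (b - c)^-1 * (f b - f c) <= e by lra.
  by rewrite mulrC ler_pdivrMr.
have left_ : f c - f a <= e * (c - a).
  have [->|ac] := eqVneq a c; first by rewrite !subrr mulr0.
  have ac0 : 0 < c - a by rewrite subr_gt0 lt_def eq_sym ac; lra.
  have := key a; rewrite distrC ger0_norm; last lra.
  move=> /(_ _ ac) hh; have {hh} : `|l - (a - c)^-1 * (f a - f c)| < e by apply: hh; lra.
  rewrite ltr_norml => /andP[hh _].
  have : (c - a)^-1 * (f c - f a) <= e.
    by rewrite -(opprB a c) -(opprB (f a)) invrN mulrNN; lra.
  by rewrite mulrC ler_pdivrMr.
lra.
Qed.

(** Non-overlapping segments of [0, s] inside O, listed from right to left: extending a family to
    the right of s is then a single [cons]. *)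
Fixpoint chain (O : set R) (s : R) (L : seq (R * R)) : Prop :=
  if L is p :: L' then
    [/\ 0 <= p.1, p.1 <= p.2, p.2 <= s, `[p.1, p.2] `<=` O & chain O p.1 L']
  else True.

Lemma chain_lengths O s L : measurable O -> chain O s L ->
  ((\sum_(p <- L) (p.2 - p.1))%:E <= @lebesgue_measure R (O `&` `[0%R, s[))%E.
Proof.
move=> mO; elim: L s => [|[l r] L IH] s /=; first by rewrite big_nil.
move=> [l0 lr rs lrO /IH hL]; rewrite big_cons /= EFinD addeC.
have -> : ((r - l)%:E = @lebesgue_measure R `[l, r[)%E.
  rewrite lebesgue_measure_itv/= lte_fin; case: ltP => //= rl.
  by have -> : r = l by [apply/eqP; rewrite eq_le rl lr]; rewrite subrr.
apply: (le_trans (leeD2r _ hL)); rewrite -measureU//=.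
- apply: le_measure; rewrite ?inE; try by do ?[apply: measurableU|apply: measurableI].
  move=> x /= [[Ox]|]; rewrite /= !in_itv /= => /andP[x1 x2]; split => //.
  + by rewrite x1 (lt_le_trans x2)// (le_trans lr).
  + by apply: lrO; rewrite /= in_itv /= x1 ltW.
  + by rewrite (le_trans l0)// (lt_le_trans x2).
- exact: measurableI.
- apply/seteqP; split => x //= [[_]]; rewrite !in_itv /= => /andP[_ xl] /andP[lx _].
  by move: lx; rewrite leNgt xl.
Qed.

Lemma chain_nth O s L : chain O s L -> forall i, (i < size L)%N ->
  [/\ 0 <= (nth (0, 0) L i).1, (nth (0, 0) L i).1 <= (nth (0, 0) L i).2,
     (nth (0, 0) L i).2 <= s &
     forall j, (i < j < size L)%N -> (nth (0, 0) L j).2 <= (nth (0, 0) L i).1].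
Proof.
elim: L s => //= p L IH s [p0 p12 ps _ /IH h] [_|i]; split => //=.
- by move=> [//|j] /= jL; have [] := h j jL.
- by have [] := h i.
- by have [] := h i.
- by have [_ _ h3 _] := h i H; rewrite (le_trans h3)// (le_trans p12).
- by move=> [//|j] /= jL; have [_ _ _] := h i (ltn_trans (andP jL).1 (andP jL).2); apply.
Qed.

Lemma chain_variation O s L f d e : s <= 1 -> chain O s L ->
  (forall (n : nat) (l r : 'I_n -> R),
      (forall k, 0 <= l k /\ l k <= r k /\ r k <= 1) ->
      (forall k k', k != k' -> r k <= l k' \/ r k' <= l k) ->
      \sum_(k < n) (r k - l k) < d ->
      \sum_(k < n) `|f (r k) - f (l k)| < e) ->
  \sum_(p <- L) (p.2 - p.1) < d -> \sum_(p <- L) `|f p.2 - f p.1| < e.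
Proof.
move=> s1 /chain_nth hL h; rewrite !(big_nth (0, 0)) !big_mkord; apply: h => [k|k k' kk'].
  by have [? ? ? _] := hL _ (ltn_ord k); do !split => //; lra.
case: (ltngtP k k') => [lt_kk'|lt_kk'|/val_inj/eqP]; last by rewrite (negPf kk').
- by right; have [_ _ _] := hL _ (ltn_ord k); apply; rewrite lt_kk' /=.
- by left; have [_ _ _] := hL _ (ltn_ord k'); apply; rewrite lt_kk' /=.
Qed.

(* Outside the null set the slope is at most e; on an open cover of the null
   set the increase is charged to the variation v of f over that cover. *)
Lemma abs_cont_nonincreasing f (N : set R) :
  abs_cont 0 1 f -> measurable N -> @lebesgue_measure R N = 0%E ->
  (forall s, 0 <= s <= 1 -> ~ N s -> derivable f s 1 /\ derive1 f s <= 0) ->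
  f 1 <= f 0.
Proof.
move=> acf mN N0 hf; apply/ler_addgt0Pr => e2 e20.
pose e := e2 / 2; have e0 : 0 < e by rewrite /e; lra.
have [d d0 hd] := acf e e0.
have muN : (@lebesgue_measure R N < +oo)%E by rewrite N0 ltry.
have [W [oW NW Wd]] := lebesgue_regularity_outer mN muN d0.
have mW : measurable W by exact: open_measurable.
have muW : (@lebesgue_measure R W < d%:E)%E.
  rewrite (_ : lebesgue_measure W = lebesgue_measure (W `\` N))%E//.
  rewrite -[in LHS](setDUK NW) measureU//=; last 2 first.
  - exact: measurableD.
  - by apply/seteqP; split => x //= [Nx [_]].
  by rewrite N0 add0e.
(* Variations of f over the families of segments of W lying to the left of s. As W has measure less
   than d, absolute continuity bounds them all by e. *)
pose V s := [set \sum_(p <- L) `|f p.2 - f p.1| | L in chain W s].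
have V0 s : V s 0 by exists [::]; rewrite ?big_nil.
have Vub s : s <= 1 -> ubound (V s) e.
  move=> s1 _ [L hL <-]; apply/ltW/(chain_variation s1 hL hd).
  rewrite -lte_fin; apply: le_lt_trans muW; apply: (le_trans (chain_lengths mW hL)).
  by apply: le_measure; rewrite ?inE//; do ?[exact: subIsetl|exact: measurableI].
pose v s := sup (V s).
have v_mono a b : a <= b -> b <= 1 -> v a <= v b.
  move=> ab b1; apply: sup_le_ub; first by exists 0.
  move=> _ [L hL <-]; apply: ub_le_sup; first by exists e; exact: Vub.
  exists L => //; case: L hL => //= p L [? ? pa ? ?]; split => //; exact: le_trans ab.
have v_jump a b : 0 <= a -> a <= b -> b <= 1 -> `[a, b] `<=` W -> v a + `|f b - f a| <= v b.
  move=> a0 ab b1 abW; rewrite -lerBrDr; apply: sup_le_ub; first by exists 0.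
  move=> _ [L hL <-]; rewrite lerBrDr; apply: ub_le_sup; first by exists e; exact: Vub.
  by exists ((a, b) :: L); rewrite ?big_cons 1?addrC//=; split.
have := @locally_nonincreasing (fun s => f s - e * s - v s).
suff hG : forall c, 0 <= c <= 1 -> exists2 d, 0 < d & forall a b,
     0 <= a -> b <= 1 -> c - d < a <= c -> c <= b < c + d ->
     f b - e * b - v b <= f a - e * a - v a.
  move=> /(_ hG); rewrite mulr1 mulr0.
  have : v 1 <= e by apply: sup_le_ub; [exists 0|exact: Vub].
  have : 0 <= v 0 by apply: ub_le_sup; [exists e; exact: Vub|exact: V0].
  rewrite /e; lra.
move=> c c01; have [Nc|Nc] := pselect (N c); last first.
  have [dfc f0] := hf c c01 Nc; have [r r0 hr] := derive_le_slope dfc f0 e0.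
  exists r => // a b a0 b1 ha hb; have := hr a b ha hb.
  have : v a <= v b by apply: v_mono => //; lra.
  lra.
have /nbhs_ballP[r /= r0 hr] : nbhs c W by exact: open_nbhs_nbhs (conj oW (NW _ Nc)).
exists r => // a b a0 b1 ha hb.
have : v a + `|f b - f a| <= v b.
  apply: v_jump => //; first lra.
  move=> x /=; rewrite in_itv /= => hx; apply: hr; rewrite /ball /= ltr_norml; lra.
have := ler_norm (f b - f a).
have : 0 <= e * (b - a) by rewrite mulr_ge0 ?(ltW e0)//; lra.
lra.
Qed.

End AbsoluteContinuity.

(** * Derivatives and trigonometric profiles *)

Section DerivativeRules.
Variable R : realType.
Implicit Types (f g : R -> R) (x : R).

Lemma is_derive_add f g x df dg : is_derive x 1 f df -> is_derive x 1 g dg ->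
  is_derive x 1 (fun t => f t + g t) (df + dg).
Proof. exact: is_deriveD. Qed.

Lemma is_derive_sub f g x df dg : is_derive x 1 f df -> is_derive x 1 g dg ->
  is_derive x 1 (fun t => f t - g t) (df - dg).
Proof. exact: is_deriveB. Qed.

Lemma is_derive_mul f g x df dg : is_derive x 1 f df -> is_derive x 1 g dg ->
  is_derive x 1 (fun t => f t * g t) (df * g x + f x * dg).
Proof.
move=> hf hg; apply: is_derive_eq (is_deriveM hf hg) _.
by rewrite /GRing.scale /= addrC mulrC.
Qed.

Lemma is_derive_scale f x c df : is_derive x 1 f df ->
  is_derive x 1 (fun t => c * f t) (c * df).
Proof. exact: is_deriveZ. Qed.

Lemma is_derive_comp f g x df dg : is_derive (g x) 1 f df -> is_derive x 1 g dg ->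
  is_derive x 1 (fun t => f (g t)) (df * dg).
Proof. exact: is_derive1_comp. Qed.

Lemma is_derive_bigsum I (r : seq I) (F : I -> R -> R) (dF : I -> R) x :
  (forall i, is_derive x 1 (F i) (dF i)) ->
  is_derive x 1 (fun t => \sum_(i <- r) F i t) (\sum_(i <- r) dF i).
Proof.
move=> h; elim: r => [|i r IH].
  by rewrite big_nil; under eq_fun do rewrite big_nil; exact: is_derive_cst.
by rewrite big_cons; under eq_fun do rewrite big_cons; exact: is_derive_add.
Qed.

Lemma is_derive_linear x c : is_derive x 1 (fun t => t * c) c.
Proof.
apply: (is_derive_eq (is_derive_mul (is_derive_id x 1) (is_derive_cst c x 1))).
by rewrite /= mul1r mulr0 addr0.
Qed.

Lemma is_derive_sqr x : is_derive x 1 (fun t => t ^+ 2) (2 * x).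
Proof.
rewrite [X in is_derive _ _ X _](_ : _ = (fun t : R => t * t)); last first.
  by apply/funext => t; rewrite expr2.
apply: (is_derive_eq (is_derive_mul (is_derive_id x 1) (is_derive_id x 1))).
by rewrite /=; ring.
Qed.

Lemma is_derive_continuous f x d : is_derive x 1 f d -> {for x, continuous f}.
Proof. by case=> df _; apply/differentiable_continuous/derivable1_diffP. Qed.

Lemma is_derive_derive1 f x d : is_derive x 1 f d -> derive1 f x = d.
Proof. by move=> h; rewrite derive1E derive_val. Qed.

Lemma is_derive_within f df a b : (forall x, a <= x <= b -> is_derive x 1 f (df x)) ->
  {within `[a, b], continuous f}.
Proof.
move=> h; apply: derivable_within_continuous => x; rewrite in_itv /= => /h hx.
exact: ex_derive.
Qed.

Lemma mean_value_bound f df a b C :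
  (forall x, a <= x <= b -> is_derive x 1 f (df x)) ->
  (forall x, a <= x <= b -> `|df x| <= C) ->
  forall s s', a <= s <= b -> a <= s' <= b -> `|f s - f s'| <= C * `|s - s'|.
Proof.
move=> hd hC s s' hs hs'; wlog ss : s s' hs hs' / s <= s' => [H|].
  by have [/H->//|/ltW/H] := leP s s'; rewrite distrC (distrC s); apply.
have sub x : s <= x <= s' -> a <= x <= b by move=> hx; lra.
have [||c cs E] := @MVT_segment R f df s s' ss.
- by move=> x; rewrite in_itv /= => hx; apply/hd/sub; lra.
- exact/(is_derive_within (df := df))/(fun x => hd x \o sub x).
rewrite distrC E normrM (distrC s) ler_wpM2r//; apply/hC/sub.
by move: cs; rewrite in_itv.
Qed.

Lemma nonincreasing_of_derive f df : (forall x, 0 <= x <= 1 -> is_derive x 1 f (df x)) ->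
  (forall x, 0 <= x <= 1 -> df x <= 0) -> forall s, 0 <= s <= 1 -> f s <= f 0.
Proof.
move=> hd h0 s /andP[s0 s1].
have [||c cs E] := @MVT_segment R f df 0 s s0.
- by move=> x; rewrite in_itv /= => hx; apply/hd; lra.
- by apply: (is_derive_within (df := df)) => x hx; apply: hd; lra.
have : df c * (s - 0) <= 0.
  by rewrite mulr_le0_ge0 ?subr0//; apply: h0; move: cs; rewrite in_itv /=; lra.
lra.
Qed.

Lemma is_derive_sinM x c : is_derive x 1 (fun t : R => sin (t * c)) (cos (x * c) * c).
Proof. exact: (is_derive_comp (f := @sin R) (g := fun t => t * c)
  (is_derive_sin _) (is_derive_linear x c)). Qed.

Lemma is_derive_cosM x c : is_derive x 1 (fun t : R => cos (t * c)) (- sin (x * c) * c).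
Proof. exact: (is_derive_comp (f := @cos R) (g := fun t => t * c)
  (is_derive_cos _) (is_derive_linear x c)). Qed.

End DerivativeRules.

Section Profiles.
Variable R : realType.
Implicit Types (mu s th : R).

(** The solution mu cot(th mu) of the Riccati equation c' = -(c^2 + mu^2) with a pole at th = 0; the
    case mu = 0 is its limit. *)
Definition cot_profile mu th : R :=
  if mu == 0 then th^-1 else mu * (cos (th * mu) / sin (th * mu)).

(** Where A^2 = -mu^2, the integral of exp(2 r A) over [0, s] equals [sin_profile mu s] +
    [versin_profile mu s] A. *)
Definition sin_profile mu s : R :=
  if mu == 0 then s else sin (s * (2 * mu)) / (2 * mu).

Definition versin_profile mu s : R :=
  if mu == 0 then s ^+ 2 else (1 - cos (s * (2 * mu))) / (2 * mu ^+ 2).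

Lemma is_derive_inv f (x d : R) : f x != 0 -> is_derive x 1 f d ->
  is_derive x 1 (fun t : R => (f t)^-1) (- (f x) ^- 2 * d).
Proof. exact: is_deriveV. Qed.

Lemma cot_profile_hcot mu : 0 <= mu -> cot_profile mu 1 = hcot (mu ^+ 2).
Proof.
move=> mu0; rewrite /cot_profile /hcot sqrf_eq0; case: ifP => _; first by rewrite invr1.
by rewrite mul1r sqrtr_sqr ger0_norm// mulrA.
Qed.

Lemma is_derive_cot_profile mu th : 0 <= mu < pi -> 0 < th <= 1 ->
  is_derive th 1 (cot_profile mu) (- (cot_profile mu th ^+ 2 + mu ^+ 2)).
Proof.
move=> /andP[mu0 mupi] /andP[th0 th1]; rewrite /cot_profile; case: ifP => [/eqP->|/negbT mun0].
  have th_n0 : id th != 0 by rewrite gt_eqF.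
  apply: (is_derive_eq (is_derive_inv th_n0 (is_derive_id th 1))).
  by rewrite expr0n addr0 mulr1 exprVn.
have {mun0}mu0 : 0 < mu by rewrite lt_def mun0.
have s0 : 0 < sin (th * mu).
  apply: sin_gt0_pi; rewrite mulr_gt0//=; apply: le_lt_trans mupi.
  by rewrite ler_piMl// ltW.
have s_n0 : sin (th * mu) != 0 by rewrite gt_eqF.
apply: (is_derive_eq (is_derive_scale mu (is_derive_mul (is_derive_cosM th mu)
  (is_derive_inv (f := fun t => sin (t * mu)) s_n0 (is_derive_sinM th mu))))).
by have := gt_eqF s0; move: (sin _) (cos _) => u v /negbT u0; field.
Qed.

Lemma cot_profile_lipschitz mu d : 0 <= mu < pi -> 0 < d <= 1 ->
  exists2 C, 0 <= C & forall s s', d <= s <= 1 -> d <= s' <= 1 ->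
    `|cot_profile mu s - cot_profile mu s'| <= C * `|s - s'|.
Proof.
move=> mupi /andP[d0 d1].
have hd x : d <= x <= 1 -> is_derive x 1 (cot_profile mu) (- (cot_profile mu x ^+ 2 + mu ^+ 2)).
  by move=> /andP[dx x1]; apply: is_derive_cot_profile => //; rewrite x1 (lt_le_trans d0).
have cont := is_derive_within hd.
have [c1 _ h1] := EVT_max d1 cont; have [c2 _ h2] := EVT_min d1 cont.
pose B := Num.max `|cot_profile mu c1| `|cot_profile mu c2|.
have hB x : d <= x <= 1 -> `|cot_profile mu x| <= B.
  move=> hx; have := h1 x; have := h2 x; rewrite in_itv /= => /(_ hx) m1 /(_ hx) m2.
  rewrite /B le_max; have := ler_norm (cot_profile mu c1); have := ler_norm (- cot_profile mu c2).
  rewrite normrN; have [x0|x0] := leP 0 (cot_profile mu x) => g1 g2.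
    by apply/orP; left; rewrite ger0_norm//; lra.
  by apply/orP; right; rewrite ltr0_norm//; lra.
exists (B ^+ 2 + mu ^+ 2); first by rewrite addr_ge0 ?sqr_ge0.
apply: (mean_value_bound hd) => x /hB hx; rewrite normrN ger0_norm ?addr_ge0 ?sqr_ge0//.
by rewrite lerD2r; move: hx; rewrite ler_norml => /andP[]; nra.
Qed.

Lemma is_derive_sin_profile mu s :
  is_derive s 1 (sin_profile mu) (1 - 2 * mu ^+ 2 * versin_profile mu s).
Proof.
rewrite /sin_profile /versin_profile; have [->|mu0] := eqVneq mu 0.
  by rewrite expr0n mulr0 mul0r subr0; exact: is_derive_id.
rewrite [X in is_derive _ _ X _](_ : _ = fun t => (2 * mu)^-1 * sin (t * (2 * mu))); last first.
  by apply/funext => t; rewrite mulrC.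
apply: (is_derive_eq (is_derive_scale _ (is_derive_sinM s (2 * mu)))).
by field.
Qed.

Lemma is_derive_versin_profile mu s :
  is_derive s 1 (versin_profile mu) (2 * sin_profile mu s).
Proof.
rewrite /sin_profile {1}/versin_profile; have [_|mu0] := eqVneq mu 0.
  exact: is_derive_sqr.
rewrite [X in is_derive _ _ X _](_ : _ =
    fun t => (2 * mu ^+ 2)^-1 * (1 - cos (t * (2 * mu)))); last first.
  by apply/funext => t; rewrite mulrC.
apply: (is_derive_eq (is_derive_scale _
  (is_derive_sub (is_derive_cst (1 : R) s 1) (is_derive_cosM s (2 * mu))))).
by field.
Qed.

Lemma sin_profile0 mu : sin_profile mu 0 = 0.
Proof. by rewrite /sin_profile mul0r sin0 mul0r; case: ifP. Qed.

Lemma versin_profile0 mu : versin_profile mu 0 = 0.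
Proof. by rewrite /versin_profile mul0r cos0 subrr mul0r expr0n; case: ifP. Qed.

Lemma sin_mul2 (x : R) : sin (2 * x) = 2 * sin x * cos x.
Proof. by rewrite mulr_natl mulr2n sinD; ring. Qed.

Lemma cos_mul2 (x : R) : cos (2 * x) = 1 - 2 * sin x ^+ 2.
Proof. by rewrite mulr_natl mulr2n cosD; have := cos2Dsin2 x; nra. Qed.

(** With A^2 = -mu^2, h = hcot(mu^2) and S, V the two profiles at 1, the two identities are the
    scalar part and the A-part of (S + V A)(h - A) = 1. *)
Lemma profile_endpoint mu : 0 <= mu < pi ->
  sin_profile mu 1 * hcot (mu ^+ 2) + versin_profile mu 1 * mu ^+ 2 = 1 /\
  versin_profile mu 1 * hcot (mu ^+ 2) = sin_profile mu 1.
Proof.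
move=> /andP[mu0 mupi]; rewrite -cot_profile_hcot// /sin_profile /versin_profile /cot_profile.
case: ifP => [/eqP->|/negbT mun0].
  by rewrite expr1n expr0n /= invr1 !mulr1 mulr0 addr0.
have s0 : 0 < sin mu by apply: sin_gt0_pi; rewrite lt_def mun0 mu0.
rewrite !mul1r sin_mul2 cos_mul2; have := cos2Dsin2 mu.
have := gt_eqF s0; move: (sin mu) (cos mu) => u v /negbT u0 uv; split.
  by rewrite -[RHS]uv; field; rewrite mun0 u0.
by field; rewrite mun0 u0.
Qed.

Lemma hcot_le1 mu : 0 <= mu < pi -> hcot (mu ^+ 2) <= 1.
Proof.
move=> /andP[mu0 mupi]; rewrite -cot_profile_hcot// /cot_profile.
case: ifP => [_|/negbT mun0]; first by rewrite invr1.
have s0 : 0 < sin mu by apply: sin_gt0_pi; rewrite lt_def mun0 mu0.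
rewrite mul1r mulrA ler_pdivrMr// mul1r.
have hd x : 0 <= x <= mu -> is_derive x 1 (fun t : R => t * cos t - sin t) (- (x * sin x)).
  move=> _; apply: (is_derive_eq (is_derive_sub
    (is_derive_mul (is_derive_id x 1) (is_derive_cos x)) (is_derive_sin x))).
  by rewrite /=; ring.
have [||c cs] := @MVT_segment R (fun t : R => t * cos t - sin t) (fun x => - (x * sin x)) 0 mu mu0.
- by move=> x; rewrite in_itv /= => hx; apply: hd; lra.
- exact: is_derive_within hd.
rewrite sin0 mul0r !subr0; move: cs; rewrite in_itv /= => /andP[c0 c1] E.
have : 0 <= c * sin c * mu.
  by rewrite !mulr_ge0// sin_ge0_pi// c0 (le_trans c1)// ltW.
by move: E; rewrite mulNr; lra.
Qed.

Lemma hcot_bounded rho : 0 <= rho < pi ->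
  exists2 C, 0 <= C & forall mu, 0 <= mu <= rho -> `|hcot (mu ^+ 2)| <= C.
Proof.
move=> /andP[rho0 rhopi]; have p0 := pi_gt0 R.
(* Below pi / 2 the cotangent is nonnegative; on [pi / 2, r] the sine decreases, so it is at least
   sin r. This explains the constant pi / sin r. *)
pose r := Num.max rho (pi / 2).
have rpi : r < pi by rewrite gt_max rhopi; lra.
have r2 : pi / 2 <= r by rewrite le_max lexx orbT.
have sr0 : 0 < sin r by apply: sin_gt0_pi; lra.
have C0 : 0 <= pi / sin r by rewrite divr_ge0 ?ltW.
exists (1 + pi / sin r); first lra.
move=> mu /andP[mu0 murho].
have mupi : 0 <= mu < pi by lra.
have := hcot_le1 mupi; rewrite ler_norml => h1; apply/andP; split; last lra.
rewrite -cot_profile_hcot// /cot_profile; case: ifP => [_|/negbT mun0]; first by rewrite invr1; lra.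
have s0 : 0 < sin mu by apply: sin_gt0_pi; rewrite lt_def mun0 mu0; lra.
rewrite mul1r; have [mu2|mu2] := leP mu (pi / 2).
  apply: (@le_trans _ _ 0); first lra.
  by rewrite mulr_ge0// divr_ge0 ?(ltW s0)// cos_ge0_pihalf//; lra.
have smu : sin r <= sin mu.
  have mur : mu <= r by rewrite le_max murho.
  rewrite -(cosBpihalf mu) -(cosBpihalf r).
  by rewrite leNgt ltr_cos ?in_itv/= -?leNgt; lra.
have q1 : mu / sin mu <= pi / sin r.
  rewrite ler_pdivrMr// mulrAC ler_pdivlMr//.
  by apply: ler_pM; lra.
rewrite mulrCA; have := cos_geN1 mu.
have : 0 <= mu / sin mu by rewrite divr_ge0 ?(ltW s0).
move: (mu / sin mu) (cos mu) q1 => a b; nra.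
Qed.

End Profiles.

(** * Arc length of absolutely continuous curves *)

Section LengthFunction.
Variable R : realType.
Notation mu := (@lebesgue_measure R).

Lemma lebesgue_null_setU (A B : set R) : measurable A -> measurable B ->
  mu A = 0%E -> mu B = 0%E -> mu (A `|` B) = 0%E.
Proof.
move=> mA mB A0 B0; apply/(@negligibleP _ _ _ mu); first exact: measurableU.
by apply: negligibleU; exact/negligibleP.
Qed.

(** The integral of a nonnegative function is a supremum over the simple functions below it, so
    monotonicity holds for arbitrary functions. It is applied to a speed whose measurability is
    established only off a null set. *)
Lemma ge0_le_integralT (f g : R -> \bar R) :
  (forall x, 0 <= f x)%E -> (forall x, f x <= g x)%E ->
  (\int[mu]_x f x <= \int[mu]_x g x)%E.
Proof.
move=> f0 fg; have g0 x : (0 <= g x)%E := le_trans (f0 x) (fg x).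
rewrite !ge0_integralE//; apply: le_ereal_sup => _ [h hf <-].
by exists h => // x; apply: (le_trans (hf x)); rewrite !patch_setT.
Qed.

Lemma abs_cont_primitive (v : R -> R) (l := fun s => \int[mu]_(x in `[0, s]) v x) :
  mu.-integrable setT (EFin \o v) -> (forall x, 0 <= v x) -> abs_cont 0 1 l.
Proof.
move=> intv v0 e e0; have [d [d0 hd]] := integral_normr_continuous intv e0.
exists d => // n a b hab dis hs.
have intS A : measurable A -> mu.-integrable A (EFin \o v).
  by move=> mA; exact: integrableS intv.
pose F (k : 'I_n) : set R := [set` `]a k, b k]].
have mF k : measurable (F k) by exact: measurable_itv.
have incr k : `|l (b k) - l (a k)| = \int[mu]_(x in F k) v x.
  have [a0 [ab b1]] := hab k.
  rewrite /l Rintegral_itvB ?bnd_simp//; last exact: intS.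
  by rewrite ger0_norm// /Rintegral fine_ge0// integral_ge0// => x _; rewrite lee_fin.
have tF : trivIset setT F.
  move=> i j _ _ [x []]; rewrite /F /= !in_itv /= => /andP[ai bi] /andP[aj bj].
  by apply/eqP; apply: contraT => /dis[] h; exfalso; lra.
pose A := \big[setU/set0]_(k < n) F k.
have mA : measurable A by apply: bigsetU_measurable => k _; exact: mF.
have muA : (mu A < d%:E)%E.
  rewrite measure_bigsetU_ord// (_ : (\sum_(k < n) _ = (\sum_(k < n) (b k - a k))%:E)%E) ?lte_fin//.
  rewrite -sumEFin; apply: eq_bigr => k _; have [a0 [ab b1]] := hab k.
  rewrite [LHS]lebesgue_measure_itv/= lte_fin; case: ltP => //= ba.
  by have -> : b k = a k by [apply/eqP; rewrite eq_le ab ba]; rewrite subrr.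
apply: le_lt_trans (hd A mA muA).
rewrite (eq_bigr _ (fun k _ => incr k)) (_ : \int[mu]_(x in A) `|v x| = \int[mu]_(x in A) v x).
  rewrite /Rintegral integral_bigsetU_EFin//.
  - rewrite sum_fine// => k _.
  apply: integrable_fin_num; first exact: mF.
  apply: intS.
  exact: mF.
  - exact: index_enum_uniq.
  - exact: sub_trivIset tF.
  - by have /integrableP[] := intS _ mA.
by apply: eq_Rintegral => x _; rewrite ger0_norm.
Qed.

(** The primitive is that of f cut off to D, which is measurable on the whole line and at most f on
    [0, 1]; hence [l 1 <= len], the direction that a lower bound on [len] requires. The set N
    collects the point 0, the complement of D in [0, 1] and the exceptional set of the
    differentiation theorem. *)
Lemma length_primitive (f : R -> R) (D : set R) (len : R) :
  measurable D -> D `<=` `[0, 1] -> mu (`[0, 1] `\` D) = 0%E ->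
  (forall x, 0 <= f x) -> measurable_fun D f ->
  (\int[mu]_(x in `[0%R, 1%R]) (f x)%:E = len%:E)%E ->
  exists (l : R -> R) (N : set R),
    [/\ abs_cont 0 1 l, l 0 = 0, forall s, 0 <= s <= 1 -> 0 <= l s <= l 1, l 1 <= len &
     [/\ measurable N, mu N = 0%E, `[0, 1] `\` D `<=` N &
        forall s, 0 <= s <= 1 -> ~ N s -> is_derive s 1 l (f s)]].
Proof.
move=> mD D01 nD f0 mf flen; pose v := f \_ D.
have v0 x : 0 <= v x by rewrite /v patchE; case: ifP.
have intle : (\int[mu]_x (v x)%:E <= len%:E)%E.
  rewrite -flen [leRHS]integral_mkcond; apply: ge0_le_integralT => x; first by rewrite lee_fin.
  rewrite /v !patchE; case: ifPn => [xD|_].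
    by rewrite mem_set//; apply: D01; rewrite inE in xD.
  by case: ifP => _; rewrite lee_fin.
have intv : mu.-integrable setT (EFin \o v).
  apply/integrableP; split.
    by apply/measurable_EFinP; exact: ((measurable_restrictT f mD).1 mf).
  apply: le_lt_trans (ltry len); apply: le_trans intle; apply: ge0_le_integralT => x //=.
  by rewrite ger0_norm.
have intS A : measurable A -> mu.-integrable A (EFin \o v).
  by move=> mA; exact: integrableS intv.
pose l s := \int[mu]_(x in `[0, s]) v x.
have ge0_l s : 0 <= l s.
  by rewrite /l /Rintegral fine_ge0// integral_ge0// => x _; rewrite lee_fin.
have locv : locally_integrable setT v by apply: open_integrable_locally => //; exact: openT.
have [N1 [mN1 N10 hN1]] := FTC1 (a := BLeft 0) (fun y => intS _ (measurable_itv _)) locv.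
exists l, (([set 0] `|` N1) `|` (`[0, 1] `\` D)); split.
- exact: abs_cont_primitive.
- by rewrite /l set_itv1 Rintegral_set1.
- move=> s /andP[s0 s1]; rewrite ge0_l /=.
  rewrite -subr_ge0 /l Rintegral_itvB ?bnd_simp//; last exact: intS.
  by rewrite /Rintegral fine_ge0// integral_ge0// => x _; rewrite lee_fin.
- rewrite -lee_fin /l /Rintegral fineK; last by apply: integrable_fin_num => //; exact: intS.
  apply: le_trans intle; rewrite integral_mkcond; apply: ge0_le_integralT => x.
    by rewrite patchE; case: ifP => //; rewrite lee_fin.
  by rewrite patchE; case: ifP => //; rewrite lee_fin.
have mC : measurable (`[0, 1] `\` D) by exact: measurableD.
have m0N1 : measurable ([set 0] `|` N1) by exact: measurableU.
split => //; first exact: measurableU.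
  by do 2?[apply: lebesgue_null_setU => //]; exact: lebesgue_measure_set1.
move=> s s01 /not_orP[/not_orP[/eqP sn0 sN1] sD].
have Ds : D s by apply: contrapT => Ds; apply: sD; split => //; rewrite /= in_itv.
have s0 : 0 < s by rewrite lt_def sn0; case/andP: s01.
have [dl' dl] : derivable l s 1 /\ derive1 l s = v s.
  apply: contrapT => h; apply: sN1; apply: hN1 => H; apply: h.
  by apply: H; rewrite /= lte_fin.
have -> : f s = v s by rewrite /v patchE mem_set.
by rewrite -dl derive1E; exact: derivableP.
Qed.

(** Composing with it extends a function on [0, 1] by constants to a continuous function on the
    line. *)
Definition clamp01 (s : R) := Num.max 0 (Num.min 1 s).

Lemma clamp01_range s : 0 <= clamp01 s <= 1.
Proof. by rewrite le_max lexx /= ge_max ler01 ge_min lexx. Qed.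

Lemma clamp01_id s : 0 <= s <= 1 -> clamp01 s = s.
Proof. by move=> /andP[s0 s1]; rewrite /clamp01 min_r// max_r. Qed.

Lemma clamp01_lipschitz s s' : s <= s' -> clamp01 s <= clamp01 s' <= clamp01 s + (s' - s).
Proof.
move=> ss; rewrite /clamp01 /Num.max /Num.min.
by case: (ltP 1 s) => ?; case: (ltP 1 s') => ?; repeat case: ltP => ?; lra.
Qed.

Lemma clamp01_continuous (f : R -> R) : abs_cont 0 1 f -> continuous (f \o clamp01).
Proof.
move=> /abs_cont_unif hf s; apply/cvgrPdist_lt => e e0; have [d d0 hd] := hf e e0.
exists d => //= s'; have [/andP[c0 c1] /andP[c0' c1']] := (clamp01_range s, clamp01_range s').
have [ss|/ltW ss] := leP s s' => sd; have := clamp01_lipschitz ss => /andP[h1 h2].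
- rewrite distrC; apply: hd => //; move: sd; rewrite /ball /= distrC ger0_norm; lra.
- apply: hd => //; move: sd; rewrite /ball /= ger0_norm; lra.
Qed.

(** The derivative is the pointwise limit of right difference quotients with step 1/(n+1), taken on
    the clamped extension because f is controlled only on [0, 1]. For s < 1 and n large the clamping
    is invisible. *)
Lemma measurable_derive1 (f : R -> R) (D : set R) : abs_cont 0 1 f -> measurable D ->
  (forall s, D s -> 0 < s < 1 /\ derivable f s 1) -> measurable_fun D (derive1 f).
Proof.
move=> acf mD hD; pose g := f \o clamp01.
have mg : measurable_fun setT g by apply: continuous_measurable_fun; exact: clamp01_continuous.
pose h (n : nat) (s : R) := n.+1%:R * (g (s + n.+1%:R^-1) - g s).
apply: (measurable_fun_cvg (h := h)) => [n|s Ds].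
  apply: (measurable_funS (E := setT)) => //; apply: measurable_funM => //.
  apply: measurable_funB => //; apply: (measurableT_comp mg).
  exact: measurable_funD.
have [s01 /cvg_ex[df hdf]] := hD s Ds.
have -> : derive1 f s = df by rewrite derive1E; apply: cvg_lim => //; exact: Rhausdorff.
move/cvgrPdist_lt : hdf => hdf; apply/cvgrPdist_lt => e /hdf [d /= d0 hd].
have nd : \forall n \near \oo, (n.+1%:R^-1 : R) < Num.min d (1 - s).
  by have := @near_infty_natSinv_lt R (PosNum (_ : 0 < Num.min d (1 - s)));
     apply; rewrite lt_min d0; lra.
near=> n; have : (n.+1%:R^-1 : R) < Num.min d (1 - s) by near: n.
rewrite lt_min => /andP[nd1 nd2]; have n0 : 0 < n.+1%:R^-1 :> R by rewrite invr_gt0.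
have := hd n.+1%:R^-1; rewrite /= sub0r normrN ger0_norm ?(ltW n0)// => /(_ nd1).
rewrite gt_eqF// => /(_ isT).
have -> : h n s = n.+1%:R^-1^-1 *: (f (n.+1%:R^-1%:A + s) - f s) => //.
move: s01 => /andP[s0 s1]; have s_n : s + n.+1%:R^-1 <= 1 by rewrite -lerBrDl ltW.
rewrite /h /g /= !clamp01_id ?s_n ?(ltW s0) ?(ltW s1) ?addr_ge0 ?(ltW n0) ?(ltW s0)//.
by rewrite invrK /GRing.scale /= mulr1 (addrC s).
Unshelve. all: by end_near. Qed.

Lemma curve_length_function n (x : R -> 'cV[R]_n) (N : set R) (len : R) :
  abs_cont_vec 0 1 x -> measurable N -> mu N = 0%E ->
  (forall s, 0 <= s <= 1 -> ~ N s -> derivable_vec x s) ->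
  (\int[mu]_(s in `[0%R, 1%R]) (eucl (dervec x s))%:E = len%:E)%E ->
  exists (l : R -> R) (N' : set R),
    [/\ abs_cont 0 1 l, l 0 = 0, forall s, 0 <= s <= 1 -> 0 <= l s <= l 1, l 1 <= len &
     [/\ measurable N', mu N' = 0%E, N `<=` N' &
        forall s, 0 <= s <= 1 -> ~ N' s -> is_derive s 1 l (eucl (dervec x s))]].
Proof.
(* The endpoints are removed because measurability of the derivative is available only in the open
   interval. *)
move=> acx mN N0 dx xlen; pose D : set R := `]0, 1[ `\` N.
have mD : measurable D by exact: measurableD.
have D01 : D `<=` `[0, 1].
  by move=> s [/=]; rewrite !in_itv /= => /andP[/ltW-> /ltW->].
have DE : `[0, 1] `\` D `<=` N `|` ([set 0] `|` [set 1]).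
  move=> s [/=]; rewrite in_itv /= => /andP[s0 s1] /not_andP[|/contrapT Ns]; last by left.
  rewrite /= in_itv /= => /negP; rewrite negb_and -!leNgt => /orP[s0'|s1']; right; [left|right].
    by apply/eqP; rewrite eq_le s0'.
  by apply/eqP; rewrite eq_le s1 s1'.
have nD : mu (`[0, 1] `\` D) = 0%E.
  apply/eqP; rewrite -measure_le0.
  apply: (@le_trans _ _ (mu (N `|` ([set 0] `|` [set 1])))).
    by apply: le_measure; rewrite ?inE//; do ?[apply: measurableD|apply: measurableU].
  rewrite lebesgue_null_setU//; first exact: measurableU.
  by rewrite lebesgue_null_setU//; exact: lebesgue_measure_set1.
have mf : measurable_fun D (fun s => eucl (dervec x s)).
  apply: (measurableT_comp (f := @Num.sqrt R)).
    by apply: continuous_measurable_fun; exact: sqrt_continuous.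
  apply: measurable_sum => i; apply: measurable_funM.
    under eq_fun do rewrite mxE; apply: measurable_derive1 => // s [/=].
    by rewrite in_itv /= => s01 Ns; split => //; apply: dx => //; lra.
  under eq_fun do rewrite mxE; apply: measurable_derive1 => // s [/=].
  by rewrite in_itv /= => s01 Ns; split => //; apply: dx => //; lra.
have [|l [N' [acl l0 lr l1 [mN' N'0 DN' dl]]]] := length_primitive mD D01 nD _ mf xlen.
  by move=> s; exact: eucl_ge0.
exists l, (N' `|` N); split => //; split.
- exact: measurableU.
- exact: lebesgue_null_setU.
- by move=> s; right.
- by move=> s s01 /not_orP[sN' _]; exact: dl.
Qed.

End LengthFunction.

(** * The lower bound for the length *)

Section VectorDerivatives.
Variable R : realType.

Definition is_vderive n (x : R -> 'cV[R]_n) (s : R) (dx : 'cV[R]_n) : Prop :=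
  forall i, is_derive s 1 (fun r => x r i 0) (dx i 0).

Lemma derivable_vec_is_vderive n (x : R -> 'cV[R]_n) s :
  derivable_vec x s -> is_vderive x s (dervec x s).
Proof. by move=> h i; rewrite mxE derive1E; exact: derivableP. Qed.

Lemma is_vderive_derivable_vec n (x : R -> 'cV[R]_n) s dx :
  is_vderive x s dx -> derivable_vec x s /\ dervec x s = dx.
Proof.
move=> h; split=> [i|]; first exact: ex_derive.
by apply/matrixP => i j; rewrite mxE (ord1 j) (is_derive_derive1 (h i)).
Qed.

Lemma is_vderive_mulmx n p (A : 'M[R]_(p, n)) (x : R -> 'cV[R]_n) s dx :
  is_vderive x s dx -> is_vderive (fun r => A *m x r) s (A *m dx).
Proof.
move=> h i; rewrite mxE; under eq_fun do rewrite mxE.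
by apply: is_derive_bigsum => k; exact: is_derive_scale.
Qed.

Lemma is_vderiveD n (x y : R -> 'cV[R]_n) s dx dy :
  is_vderive x s dx -> is_vderive y s dy -> is_vderive (fun r => x r + y r) s (dx + dy).
Proof.
move=> hx hy i; rewrite mxE; under eq_fun do rewrite mxE.
exact: is_derive_add.
Qed.

Lemma is_vderiveB n (x y : R -> 'cV[R]_n) s dx dy :
  is_vderive x s dx -> is_vderive y s dy -> is_vderive (fun r => x r - y r) s (dx - dy).
Proof.
move=> hx hy i; rewrite !mxE; under eq_fun do rewrite !mxE.
exact: is_derive_sub.
Qed.

Lemma is_vderive_scale n (f : R -> R) (u : 'cV[R]_n) (s df : R) :
  is_derive s 1 f df -> is_vderive (fun r => f r *: u) s (df *: u).
Proof.
move=> hf i; rewrite mxE; under eq_fun do rewrite mxE.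
apply: (is_derive_eq (is_derive_mul hf (is_derive_cst (u i 0) s 1))).
by rewrite mulr0 addr0.
Qed.

Lemma is_vderive_sum n I (r : seq I) (x : I -> R -> 'cV[R]_n) s dx :
  (forall k, is_vderive (x k) s (dx k)) ->
  is_vderive (fun t => \sum_(k <- r) x k t) s (\sum_(k <- r) dx k).
Proof.
move=> h i; rewrite summxE; under eq_fun do rewrite summxE.
by apply: is_derive_bigsum => k; exact: h.
Qed.

Lemma is_derive_dotv n (x y : R -> 'cV[R]_n) s dx dy :
  is_vderive x s dx -> is_vderive y s dy ->
  is_derive s 1 (fun r => dotv (x r) (y r)) (dotv dx (y s) + dotv (x s) dy).
Proof.
move=> hx hy; rewrite /dotv -big_split /=.
by apply: is_derive_bigsum => k; exact: is_derive_mul.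
Qed.

Lemma is_derive_dotv_cst n (x : R -> 'cV[R]_n) s dx (u : 'cV[R]_n) :
  is_vderive x s dx -> is_derive s 1 (fun r => dotv (x r) u) (dotv dx u).
Proof.
move=> hx; apply: (is_derive_eq (is_derive_dotv hx (dy := 0) _)); last by rewrite dotv0 addr0.
by move=> i; rewrite mxE; exact: is_derive_cst.
Qed.

Lemma abs_cont_dotv n (x y : R -> 'cV[R]_n) :
  abs_cont_vec 0 1 x -> abs_cont_vec 0 1 y -> abs_cont 0 1 (fun s => dotv (x s) (y s)).
Proof. by move=> hx hy; apply: abs_cont_sum => i; exact: abs_contM. Qed.

Lemma abs_cont_mulmx n p (A : 'M[R]_(p, n)) (x : R -> 'cV[R]_n) :
  abs_cont_vec 0 1 x -> abs_cont_vec 0 1 (fun s => A *m x s).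
Proof.
move=> hx i; under [fun s => _]eq_fun do rewrite mxE.
exact: (abs_cont_sum _ (fun k => abs_contZ (A i k) (hx k))).
Qed.

End VectorDerivatives.

(** * Functional calculus of a skew-symmetric matrix *)

Section SpectralCalculus.
Variables (R : realType) (n N : nat) (A : 'M[R]_n) (mu : 'I_N -> R) (P : 'I_N -> 'M[R]_n).
Hypotheses (skA : A^T = - A) (sp : skew_spectrum A mu P).

Definition spfun (c : 'I_N -> R) : 'M[R]_n := \sum_i c i *: P i.

Lemma spfunM c d : spfun c *m spfun d = spfun (fun i => c i * d i).
Proof.
rewrite mulmx_suml; apply: eq_bigr => i _.
rewrite mulmx_sumr (bigD1 i)//= -scalemxAl -scalemxAr (sp_idem sp) scalerA.
rewrite big1 ?addr0// => j ji.
by rewrite -scalemxAl -scalemxAr (sp_orth sp) ?scaler0// eq_sym.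
Qed.

Lemma spfunD c d : spfun c + spfun d = spfun (fun i => c i + d i).
Proof. by rewrite -big_split; apply: eq_bigr => i _; rewrite scalerDl. Qed.

Lemma spfunZ a c : a *: spfun c = spfun (fun i => a * c i).
Proof. by rewrite scaler_sumr; apply: eq_bigr => i _; rewrite scalerA. Qed.

Lemma spfun1 : spfun (fun=> 1) = 1%:M.
Proof. by rewrite -(sp_sum sp); apply: eq_bigr => i _; rewrite scale1r. Qed.

Lemma spfun_sym c : (spfun c)^T = spfun c.
Proof. by rewrite linear_sum; apply: eq_bigr => i _; rewrite linearZ /= (sp_sym sp). Qed.

Lemma spfun_comm c : A *m spfun c = spfun c *m A.
Proof.
rewrite mulmx_sumr mulmx_suml; apply: eq_bigr => i _.
by rewrite -scalemxAl -scalemxAr (sp_comm sp).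
Qed.

Lemma skew_sqr : A *m A = spfun (fun i => - (mu i ^+ 2)).
Proof.
rewrite -[LHS]mulmx1 -spfun1 -mulmxA !mulmx_sumr.
by apply: eq_bigr => i _; rewrite scale1r (sp_sqr sp).
Qed.

Lemma dotv_spfun c u v : dotv (spfun c *m u) v = \sum_i c i * dotv (P i *m u) v.
Proof.
rewrite mulmx_suml dotv_suml; apply: eq_bigr => i _.
by rewrite -scalemxAl dotvZl.
Qed.

Lemma dotv_spfun_skew c u : dotv (spfun c *m u) (A *m u) = 0.
Proof.
rewrite dotv_trmx spfun_sym mulmxA -spfun_comm dotvC dotv_skew_self//.
by rewrite trmx_mul spfun_sym skA mulmxN spfun_comm.
Qed.

Lemma dotv_proj_ge0 i u : 0 <= dotv (P i *m u) u.
Proof. by rewrite -(sp_idem sp) -mulmxA dotv_trmx (sp_sym sp) dotv_ge0. Qed.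

(** The cross terms vanish because [spfun c] commutes with A, so their product is skew. The
    coefficients c^2 + mu^2 are those of the Riccati equation of [cot_profile], which is what lets
    the square be completed. *)
Lemma sqr_spfun_add_skew c u :
  dotv (spfun c *m u + A *m u) (spfun c *m u + A *m u) =
  \sum_i (c i ^+ 2 + mu i ^+ 2) * dotv (P i *m u) u.
Proof.
rewrite dotvDl !dotvDr (dotvC (A *m u)) !dotv_spfun_skew addr0 add0r.
rewrite dotv_trmx spfun_sym mulmxA spfunM dotv_skew// mulmxA skew_sqr.
rewrite !(dotvC u) !dotv_spfun -sumrN -big_split; apply: eq_bigr => i _ /=.
by rewrite mulrDl; ring.
Qed.

End SpectralCalculus.

Section LengthLowerBound.
Variables (R : realType) (q m : nat) (U : 'I_m -> 'M[R]_q).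
Hypothesis skU : forall j, (U j)^T = - U j.
Notation mu := (@lebesgue_measure R).

Lemma Amat_skew tau : (Amat U tau)^T = - Amat U tau.
Proof.
by rewrite linear_sum -sumrN; apply: eq_bigr => j _; rewrite linearZ /= skU scalerN.
Qed.

Lemma dotv_Uform (x y : 'cV[R]_q) tau : dotv (Uform U x y) tau = dotv (Amat U tau *m x) y.
Proof.
rewrite mulmx_suml dotv_suml; apply: eq_bigr => j _.
by rewrite mxE -scalemxAl dotvZl mulrC.
Qed.

(* Along the curve reparametrised by th = (l + e) / L, the function
   H = sum_i c_i(th) |P_i x|^2 + 4 tau.t - L l is a subsolution of the
   Hamilton-Jacobi equation: completing the square bounds H' by 0. *)
Lemma phi_le_sqr_length (g : Gpt R q m) x t tau (len : R) :
  horizontal_curve U g x t -> Omega_star U tau ->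
  (\int[mu]_(s in `[0%R, 1%R]) (eucl (dervec x s))%:E = len%:E)%E ->
  phi U g tau <= len ^+ 2.
Proof.
move=> [[x0 t0 x1 t1] [acx act [N [mN N0 hN]]]] tau_pi xlen.
set A := Amat U tau; have skA : A^T = - A by exact: Amat_skew.
have [K [nu [P sp]]] := skew_spectrumP skA.
have hcurve s : 0 <= s <= 1 -> ~ N s -> [/\ derivable_vec x s, derivable_vec t s &
    dervec t s = 2^-1 *: Uform U (x s) (dervec x s)].
  move=> s01 Ns; apply: contrapT => h; apply: Ns; apply: hN => /= H; apply: h.
  by apply: H; rewrite in_itv.
have [|l [N' [acl l0 lr l1 [mN' N'0 NN' dl]]]] := curve_length_function acx mN N0 _ xlen.
  by move=> s s01 /(hcurve s s01)[].
have l10 : 0 <= l 1 by have := lr 0; rewrite lexx ler01 l0 => /(_ isT) /andP[].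
suff key e : 0 < e -> phi U g tau <= (l 1 + e) * l 1.
  apply: (@le_trans _ _ (l 1 * l 1)); last by rewrite -expr2 lerXn2r ?nnegrE//; lra.
  apply/ler_addgt0Pr => e e0; have e' : 0 < e / (l 1 + 1) by rewrite divr_gt0//; lra.
  apply: (le_trans (key _ e')); rewrite mulrDl lerD2l.
  rewrite mulrAC ler_pdivrMr; last lra.
  by rewrite ler_pM2l//; lra.
(* The shift by e keeps th in [e / L, 1], away from the pole of [cot_profile] at 0, while th = 1 at
   the end of the curve, where H recovers [phi]. *)
move=> e0; pose L := l 1 + e; have L0 : 0 < L by rewrite /L; lra.
pose th s := (l s + e) / L.
have nupi i : 0 <= nu i < pi.
  by have /andP[-> /le_lt_trans->] := sp_mu sp i.
have th01 s : 0 <= s <= 1 -> e / L <= th s <= 1.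
  move=> /lr /andP[ls0 ls1]; rewrite /th ler_pM2r ?invr_gt0// ler_pdivrMr// mul1r /L; lra.
have eL : 0 < e / L <= 1 by rewrite divr_gt0// ler_pdivrMr// mul1r /L; lra.
pose c i s := cot_profile (nu i) (th s).
pose H s := \sum_i c i s * dotv (P i *m x s) (x s) + 4 * dotv (t s) tau - L * l s.
have acth : abs_cont 0 1 th.
  have -> : th = (fun s => L^-1 * (l s + e)) by apply/funext => s; rewrite mulrC.
  by apply/abs_contZ/abs_contD => //; exact: abs_cont_cst.
have acc i : abs_cont 0 1 (c i).
  have [C C0 hC] := cot_profile_lipschitz (nupi i) eL.
  apply: (abs_cont_dom C0 _ acth acth) => s s' hs hs'.
  apply: (le_trans (hC _ _ (th01 _ hs) (th01 _ hs'))).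
  by rewrite ler_wpM2l// lerDl.
have acH : abs_cont 0 1 H.
  apply: abs_contD; first apply: abs_contD.
  - apply: abs_cont_sum => i; apply: abs_contM => //.
    by apply: abs_cont_dotv => //; exact: abs_cont_mulmx.
  - by apply/abs_contZ/abs_cont_dotv => // i; exact: abs_cont_cst.
  - under [fun s => _]eq_fun do rewrite -mulNr.
    exact: abs_contZ.
have H0 : H 0 = 0.
  rewrite /H x0 t0 l0 dot0v !mulr0 subr0 addr0 big1// => i _.
  by rewrite mulmx0 dot0v mulr0.
have H1 : H 1 = phi U g tau - L * l 1.
  rewrite /H x1 t1 /phi /UcotU -/A (sp_matfun sp) dotv_spfun; congr (_ + _ - _).
  apply: eq_bigr => i _; rewrite /c (_ : th 1 = 1); last by rewrite /th mulfV ?gt_eqF.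
  by have /andP[nu0 _] := nupi i; rewrite cot_profile_hcot.
suff : H 1 <= H 0 by rewrite H0 H1 /L; lra.
apply: (abs_cont_nonincreasing acH mN' N'0) => s s01 N's.
have Ns : ~ N s by move=> /NN'.
have [/derivable_vec_is_vderive dx /derivable_vec_is_vderive dt tE] := hcurve s s01 Ns.
have {}dl := dl s s01 N's; set x' := dervec x s in dx tE dl; set v := eucl x' in dl.
have dth : is_derive s 1 th (v / L).
  rewrite (_ : th = fun r => (l r + e) * L^-1)//.
  apply: (is_derive_eq (is_derive_mul
    (is_derive_add dl (is_derive_cst e s 1)) (is_derive_cst L^-1 s 1))).
  by rewrite addr0 mulr0 addr0.
have dc i : is_derive s 1 (c i) (- (c i s ^+ 2 + nu i ^+ 2) * (v / L)).
  apply: is_derive_comp dth; apply: is_derive_cot_profile => //.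
  by have /andP[h1 ->] := th01 s s01; rewrite (lt_le_trans _ h1)//; case/andP: eL.
have dP i : is_derive s 1 (fun r => dotv (P i *m x r) (x r)) (2 * dotv (P i *m x s) x').
  apply: (is_derive_eq (is_derive_dotv (is_vderive_mulmx (P i) dx) dx)).
  by rewrite dotv_trmx (sp_sym sp) dotvC; ring.
(* 2 w is the horizontal gradient of the first two terms of H at fixed th: the vertical term
   contributes 4 tau.t' = 2 <A x, x'>. *)
pose w := spfun P (c ^~ s) *m x s + A *m x s.
have dH : is_derive s 1 H (- (v / L) * dotv w w + 2 * dotv w x' - L * v).
  apply: (is_derive_eq (is_derive_sub (is_derive_add
    (is_derive_bigsum _ (fun i => is_derive_mul (dc i) (dP i)))
    (is_derive_scale 4 (is_derive_dotv_cst tau dt))) (is_derive_scale L dl))).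
  rewrite tE dotvZl dotv_Uform -/A (sqr_spfun_add_skew skA sp) dotvDl dotv_spfun.
  set S1 := \sum_i (_ + _) * dotv _ _; set S2 := \sum_i c i s * _.
  rewrite [X in X + _ - _](_ : _ = - (v / L) * S1 + 2 * S2); last first.
    by rewrite !mulr_sumr -big_split; apply: eq_bigr => i _ /=; ring.
  by field; rewrite gt_eqF.
split; first exact: ex_derive.
rewrite (is_derive_derive1 dH).
have hw := dotv_le w x'; rewrite -/v in hw.
have v0 : 0 <= v := eucl_ge0 _.
have : 0 <= (v / L) * (eucl w - L) ^+ 2 by rewrite mulr_ge0 ?sqr_ge0// divr_ge0// ltW.
have -> : (v / L) * (eucl w - L) ^+ 2 = (v / L) * dotv w w - 2 * eucl w * v + L * v.
  by rewrite -sqr_eucl; field; rewrite gt_eqF.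
lra.
Qed.

End LengthLowerBound.

(** * Geodesics *)

Section Geodesics.
Variables (R : realType) (q m : nat) (U : 'I_m -> 'M[R]_q).
Hypothesis skU : forall j, (U j)^T = - U j.
Notation mu := (@lebesgue_measure R).
Implicit Types (A B : 'M[R]_q) (p : 'cV[R]_q) (x y : R -> 'cV[R]_q) (s : R).

Lemma constant_of_derive (f : R -> R) :
  (forall s, 0 <= s <= 1 -> is_derive s 1 f 0) -> forall s, 0 <= s <= 1 -> f s = f 0.
Proof.
move=> h s s01; have := @mean_value_bound R f (fun=> 0) 0 1 0 h _ s 0 s01.
rewrite mul0r normr0 lexx ler01 => /(_ (fun _ _ => isT) isT).
by rewrite normr_le0 subr_eq0 => /eqP.
Qed.

Lemma continuous_primitive (f : R -> R) : continuous f ->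
  exists2 F : R -> R, F 0 = 0 & forall s, 0 <= s <= 1 -> is_derive s 1 F (f s).
Proof.
(* Integration starts at -1 and runs within [-1, 2], so that 0 and 1 are interior and the derivative
   there is two-sided. *)
move=> cf; pose G s := \int[mu]_(x in `[(-1), s]) f x.
exists (fun s => G s - G 0) => [|s s01]; first by rewrite subrr.
have intf : mu.-integrable `[(-1), 2] (EFin \o f).
  by apply: continuous_compact_integrable; [exact: segment_compact|exact: continuous_subspaceT].
have s2 : s < 2 by lra.
have s1 : -1 < s by lra.
have [dG GE] := continuous_FTC1_closed s2 intf s1 (cf s).
have hG : is_derive s 1 G (f s) by rewrite -GE derive1E; exact: derivableP.
by apply: (is_derive_eq (is_derive_sub hG (is_derive_cst (G 0) s 1))); rewrite subr0.
Qed.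

(* For d' = 2 A d + w with A skew, <A d, d> = 0, so exp(-s)(|d|^2 + eta^2)
   decreases as soon as |w| <= eta. *)
Lemma skew_gronwall n (A : 'M[R]_n) (d w : R -> 'cV[R]_n) eta :
  A^T = - A -> d 0 = 0 ->
  (forall s, 0 <= s <= 1 -> is_vderive d s (2 *: (A *m d s) + w s)) ->
  (forall s, 0 <= s <= 1 -> eucl (w s) <= eta) ->
  forall s, 0 <= s <= 1 -> eucl (d s) <= expR 1 * eta.
Proof.
move=> skA d0 hd hw s s01.
have eta0 : 0 <= eta by apply: le_trans (hw s s01); exact: eucl_ge0.
pose f r := expR (r * -1) * (dotv (d r) (d r) + eta ^+ 2).
have df (r : R) : 0 <= r <= 1 -> is_derive r 1 f
    (expR (r * -1) * (2 * dotv (w r) (d r) - dotv (d r) (d r) - eta ^+ 2)).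
  move=> r01; have hr := hd r r01.
  apply: (is_derive_eq (is_derive_mul
    (is_derive_comp (f := expR) (g := fun t => t * -1) (is_derive_expR _) (is_derive_linear r (-1)))
    (is_derive_add (is_derive_dotv hr hr) (is_derive_cst (eta ^+ 2) r 1)))).
  rewrite (dotvC (d r) (_ + _)) dotvDl dotvZl dotv_skew_self//=; ring.
have := nonincreasing_of_derive df _ s01.
rewrite /f d0 dot0v mul0r expR0 mul1r add0r mulrN1 => H.
have {}H : expR (- s) * (dotv (d s) (d s) + eta ^+ 2) <= eta ^+ 2.
  apply: H => r r01; rewrite mulr_ge0_le0 ?expR_ge0// -sqr_eucl.
  have := dotv_le (w r) (d r); have := hw r r01; have := eucl_ge0 (d r).
  have := sqr_ge0 (eucl (d r) - eta); nra.
have e1 : 1 <= expR 1 :> R by rewrite -expR0 ler_expR.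
have : dotv (d s) (d s) + eta ^+ 2 <= expR 1 * eta ^+ 2.
  have : expR s * (expR (- s) * (dotv (d s) (d s) + eta ^+ 2)) <= expR s * eta ^+ 2.
    by rewrite ler_wpM2l ?expR_ge0.
  rewrite mulrA -expRD subrr expR0 mul1r => /le_trans; apply.
  by rewrite ler_wpM2r ?sqr_ge0// ler_expR; case/andP: s01.
move=> h; apply: eucl_le; first by rewrite mulr_ge0// expR_ge0.
have := sqr_ge0 eta; rewrite exprMn; move: h e1.
move: (expR 1) (eta ^+ 2) (dotv _ _) => e a b h e1 a0.
have : 0 <= e * ((e - 1) * a) by rewrite !mulr_ge0//; lra.
nra.
Qed.

(** The equation is x'' = 2 A x' integrated once, with p the initial velocity, and t is the
    horizontal lift of x. A is a free matrix here, so that geodesics with different parameters can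
    be compared. *)
Definition geodesic A p x (t : R -> 'cV[R]_m) : Prop :=
  [/\ x 0 = 0, t 0 = 0,
    forall s, 0 <= s <= 1 -> is_vderive x s (2 *: (A *m x s) + p) &
    forall s, 0 <= s <= 1 ->
      is_vderive t s (2^-1 *: Uform U (x s) (2 *: (A *m x s) + p))].

(** The second derivative serves to make the integrand continuous, so that its primitive is
    differentiable at every point. *)
Lemma vertical_lift x dx ddx : (forall s, is_vderive x s (dx s)) ->
  (forall s, is_vderive dx s (ddx s)) ->
  exists2 t : R -> 'cV[R]_m, t 0 = 0 &
    forall s, 0 <= s <= 1 -> is_vderive t s (2^-1 *: Uform U (x s) (dx s)).
Proof.
move=> hx hdx; pose f j s := 2^-1 * dotv (U j *m x s) (dx s).
have cf j : continuous (f j).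
  move=> s; apply: is_derive_continuous.
  exact: (is_derive_scale _ (is_derive_dotv (is_vderive_mulmx (U j) (hx s)) (hdx s))).
have /boolp.choice[F hF] : forall j, exists F : R -> R, F 0 = 0 /\
    forall s, 0 <= s <= 1 -> is_derive s 1 F (f j s).
  by move=> j; have [F F0 dF] := continuous_primitive (cf j); exists F.
exists (fun s => \col_j F j s).
  by apply/matrixP => j k; rewrite !mxE; have [] := hF j.
move=> s s01 j; rewrite !mxE; under eq_fun do rewrite mxE.
by have [_] := hF j; apply.
Qed.

(** * Explicit solution of x' = 2 A x + p *)

Section ExplicitSolution.
Variables (A : 'M[R]_q) (N : nat) (nu : 'I_N -> R) (P : 'I_N -> 'M[R]_q).
Hypothesis sp : skew_spectrum A nu P.

(** The integral of exp(2 r A) over [0, s], written block by block; it maps p to x(s). *)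
Definition flow_mx s : 'M[R]_q :=
  spfun P (fun i => sin_profile (nu i) s) + A *m spfun P (fun i => versin_profile (nu i) s).

Lemma is_vderive_spfun (c dc : 'I_N -> R -> R) p s :
  (forall i, is_derive s 1 (c i) (dc i s)) ->
  is_vderive (fun r => spfun P (c ^~ r) *m p) s (spfun P (dc ^~ s) *m p).
Proof.
move=> hc; have E (e : 'I_N -> R -> R) r : spfun P (e ^~ r) *m p = \sum_i e i r *: (P i *m p).
  by rewrite mulmx_suml; apply: eq_bigr => i _; rewrite scalemxAl.
rewrite E (_ : (fun r => _) = (fun r => \sum_i c i r *: (P i *m p))); last first.
  by apply/funext => r; rewrite E.
by apply: is_vderive_sum => i; exact: is_vderive_scale.
Qed.

Lemma flow_mx_ode p s :
  is_vderive (fun r => flow_mx r *m p) s (2 *: (A *m (flow_mx s *m p)) + p).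
Proof.
have -> : 2 *: (A *m (flow_mx s *m p)) + p =
    spfun P (fun i => 1 - 2 * nu i ^+ 2 * versin_profile (nu i) s) *m p +
    A *m (spfun P (fun i => 2 * sin_profile (nu i) s) *m p).
  rewrite !mulmxA -mulmxDl -[in LHS](mul1mx p) !mulmxA mulmx1 scalemxAl -mulmxDl; congr (_ *m p).
  rewrite mulmxDr mulmxA (skew_sqr sp) (spfunM sp) scalerDr scalemxAr !spfunZ -(spfun1 sp).
  rewrite -addrA addrC spfunD; congr (_ + _); congr spfun; apply/funext => i; ring.
rewrite (_ : (fun r => _) = (fun r => spfun P (fun i => sin_profile (nu i) r) *m p +
  A *m (spfun P (fun i => versin_profile (nu i) r) *m p))); last first.
  by apply/funext => r; rewrite mulmxDl mulmxA.
apply: is_vderiveD; first by apply: (is_vderive_spfun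
    (dc := fun i r => 1 - 2 * nu i ^+ 2 * versin_profile (nu i) r)) => i;
  exact: is_derive_sin_profile.
apply: is_vderive_mulmx; apply: (is_vderive_spfun (dc := fun i r => 2 * sin_profile (nu i) r)) => i.
exact: is_derive_versin_profile.
Qed.

Lemma flow_mx0 : flow_mx 0 = 0.
Proof.
rewrite /flow_mx /spfun !big1 ?mulmx0 ?addr0// => i _.
  by rewrite versin_profile0 scale0r.
by rewrite sin_profile0 scale0r.
Qed.

(** This is the origin of the initial velocity (U cot U - A) X: it inverts the endpoint map p |->
    x(1), and [profile_endpoint] is the verification on each block. *)
Lemma flow_mx1_inverse : opnorm A < pi ->
  flow_mx 1 *m (spfun P (fun i => hcot (nu i ^+ 2)) - A) = 1%:M.
Proof.
move=> Api; have nupi i : 0 <= nu i < pi by have /andP[-> /le_lt_trans->] := sp_mu sp i.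
rewrite /flow_mx mulmxBr !mulmxDl -!mulmxA !(spfunM sp) -!(spfun_comm sp) !mulmxA (skew_sqr sp).
rewrite (spfunM sp) opprD addrACA -[X in _ + X]addrC -addrA.
set a := spfun P _; set b := A *m _; set c := A *m _; set d := spfun P _.
have -> : b = c.
  by congr (A *m spfun P _); apply/funext => i; have [_ ->] := profile_endpoint (nupi i).
have -> : a = 1%:M - - d.
  rewrite opprK -(spfun1 sp) spfunD; congr spfun; apply/funext => i.
  by have [+ _] := profile_endpoint (nupi i); lra.
by move: c d => c d; apply/matrixP => i j; rewrite !mxE; ring.
Qed.

End ExplicitSolution.

Lemma geodesic_acceleration A p x s (v := fun r => 2 *: (A *m x r) + p) :
  is_vderive x s (v s) -> is_vderive v s (2 *: (A *m v s)).
Proof.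
move=> hx i; have h := is_vderive_mulmx (2 *: A) hx i.
rewrite [X in is_derive _ _ X _](_ : _ = fun r => ((2 *: A) *m x r) i 0 + p i 0).
  apply: (is_derive_eq (is_derive_add h (is_derive_cst (p i 0) s 1))).
  by rewrite addr0 scalemxAl.
by apply/funext => r; rewrite /v -scalemxAl mxE.
Qed.

Lemma geodesic_exists A p : A^T = - A -> exists x t, geodesic A p x t.
Proof.
move=> skA; have [N [nu [P sp]]] := skew_spectrumP skA.
have ode := flow_mx_ode sp p; set x := (fun r => _) in ode.
have [t t0 ht] := vertical_lift ode (fun s => geodesic_acceleration (ode s)).
by exists x, t; split => //; rewrite /x flow_mx0 mul0mx.
Qed.

Lemma skew_ode_unique A p x y : A^T = - A -> x 0 = 0 -> y 0 = 0 ->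
  (forall s, 0 <= s <= 1 -> is_vderive x s (2 *: (A *m x s) + p)) ->
  (forall s, 0 <= s <= 1 -> is_vderive y s (2 *: (A *m y s) + p)) ->
  forall s, 0 <= s <= 1 -> x s = y s.
Proof.
move=> skA x0 y0 hx hy s s01.
have := @skew_gronwall _ A (fun s => x s - y s) (fun=> 0) 0 skA _ _ _ s s01.
rewrite x0 y0 subrr mulr0 => /(_ erefl) H.
have : eucl (x s - y s) <= 0.
  apply: H => [u u01|u _]; last by rewrite eucl0.
  have := is_vderiveB (hx u u01) (hy u u01).
  by rewrite opprD addrACA subrr -scalerBr -mulmxBr.
have := eucl_ge0 (x s - y s) => h1 h2.
have /eucl_eq0/eqP : eucl (x s - y s) = 0 by lra.
by rewrite subr_eq0 => /eqP.
Qed.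

Lemma geodesic_endpoint A N (nu : 'I_N -> R) (P : 'I_N -> 'M[R]_q) p x t :
  A^T = - A -> skew_spectrum A nu P -> geodesic A p x t -> x 1 = flow_mx A nu P 1 *m p.
Proof.
move=> skA sp [x0 _ hx _].
apply: (skew_ode_unique (y := fun s => flow_mx A nu P s *m p) skA x0 _ hx).
- by rewrite flow_mx0 mul0mx.
- by move=> s _; exact: flow_mx_ode.
- by rewrite ler01 lexx.
Qed.

Lemma geodesic_speed A p x t : A^T = - A -> geodesic A p x t ->
  forall s, 0 <= s <= 1 -> eucl (2 *: (A *m x s) + p) = eucl p.
Proof.
move=> skA [x0 _ hx _] s s01; rewrite /eucl; congr Num.sqrt.
pose v s := 2 *: (A *m x s) + p.
have dv u : 0 <= u <= 1 -> is_vderive v u (2 *: (A *m v u)).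
  by move=> u01; exact: geodesic_acceleration (hx u u01).
rewrite -/(v s) (_ : dotv p p = dotv (v 0) (v 0)); last by rewrite /v x0 mulmx0 scaler0 add0r.
apply: (@constant_of_derive (fun s => dotv (v s) (v s))) => // u u01.
apply: (is_derive_eq (is_derive_dotv (dv u u01) (dv u u01))).
by rewrite (dotvC (v u)) dotvZl dotv_skew_self// mulr0 addr0.
Qed.

Lemma geodesic_bound A p x t : A^T = - A -> geodesic A p x t ->
  forall s, 0 <= s <= 1 -> eucl (x s) <= expR 1 * eucl p.
Proof. by move=> skA [x0 _ hx _]; exact: (skew_gronwall skA x0 hx). Qed.

Lemma geodesic_horizontal A p x t : A^T = - A -> geodesic A p x t ->
  horizontal_curve U (x 1, t 1) x t /\
  (\int[mu]_(s in `[0%R, 1%R]) (eucl (dervec x s))%:E = (eucl p)%:E)%E.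
Proof.
move=> skA geo; have speed := geodesic_speed skA geo; have bound := geodesic_bound skA geo.
case: geo => x0 t0 hx ht; split; first split => //; first split.
- move=> i; apply: (lipschitz_abs_cont (C := eucl p)); first exact: eucl_ge0.
  apply: (mean_value_bound (fun s s01 => hx s s01 i)) => s s01.
  by rewrite -(speed s s01) coord_le_eucl.
- move=> j; apply: (lipschitz_abs_cont (C := mnorm (U j) * (expR 1 * eucl p) * eucl p)).
    by rewrite !mulr_ge0 ?mnorm_ge0 ?eucl_ge0 ?expR_ge0.
  apply: (mean_value_bound (fun s s01 => ht s s01 j)) => s s01.
  rewrite !mxE normrM ger0_norm ?invr_ge0//.
  apply: (@le_trans _ _ (1 * (eucl (U j *m x s) * eucl p))).
    apply: ler_pM => //; first lra.
    by rewrite -(speed s s01) normr_dotv_le.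
  rewrite mul1r ler_wpM2r ?eucl_ge0// (le_trans (eucl_mulmx _ _))//.
  by rewrite ler_wpM2l ?mnorm_ge0// bound.
- apply: aeW => s; rewrite in_itv /= => s01.
  have [dx xE] := is_vderive_derivable_vec (hx s s01).
  by have [dt tE] := is_vderive_derivable_vec (ht s s01); rewrite tE xE.
rewrite (eq_integral (fun=> (eucl p)%:E)) => [|s].
  by rewrite integral_cst//= lebesgue_measure_itv/= lte_fin ltr01 oppr0 adde0 mule1.
rewrite inE /= in_itv /= => s01.
by have [_ ->] := is_vderive_derivable_vec (hx s s01); rewrite speed.
Qed.

(** With v = x', the quantity <v, x> + 4 tau.t grows at the constant rate |p|^2: the term 2 <A v, x>
    coming from v' cancels 2 <A x, v> coming from 4 tau.t'. *)
Lemma geodesic_energy tau p x t : geodesic (Amat U tau) p x t ->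
  dotv p p = dotv (2 *: (Amat U tau *m x 1) + p) (x 1) + 4 * dotv (t 1) tau.
Proof.
set A := Amat U tau => geo; have skA : A^T = - A by exact: Amat_skew.
have speed := geodesic_speed skA geo; case: geo => x0 t0 hx ht.
pose v s := 2 *: (A *m x s) + p.
have dv u : 0 <= u <= 1 -> is_vderive v u (2 *: (A *m v u)).
  by move=> u01; exact: geodesic_acceleration (hx u u01).
pose f s := dotv (v s) (x s) + 4 * dotv (t s) tau - s * dotv p p.
suff : f 1 = f 0.
  by rewrite /f /v x0 t0 dotv0 dot0v !mulr0 mul0r mul1r -/A; lra.
apply: constant_of_derive; last by rewrite lexx ler01.
move=> s s01; apply: (is_derive_eq (is_derive_sub (is_derive_add
  (is_derive_dotv (dv s s01) (hx s s01))
  (is_derive_scale 4 (is_derive_dotv_cst tau (ht s s01)))) (is_derive_linear s (dotv p p)))).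
rewrite -/(v s) !dotvZl dotv_Uform -/A dotv_skew// (dotvC (v s) (A *m x s)).
by rewrite -(sqr_eucl (v s)) (speed s s01) sqr_eucl; field.
Qed.

(** The difference of the horizontal parts solves the equation of A with forcing [w], of size O(|A -
    B| + |p - p'|), so [skew_gronwall] applies. The vertical parts follow from the mean value bound
    for the difference of the forms <U j x, x'>. *)
Lemma geodesic_stability K : 0 <= K -> exists2 C, 0 <= C &
  forall A B p p' x t y r, A^T = - A -> B^T = - B ->
    mnorm A <= K -> eucl p <= K -> eucl p' <= K ->
    geodesic A p x t -> geodesic B p' y r ->
    eucl (x 1 - y 1) <= C * (mnorm (A - B) + eucl (p - p')) /\
    forall j, `|t 1 j 0 - r 1 j 0| <= C * (mnorm (A - B) + eucl (p - p')).
Proof.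
move=> K0; set E : R := expR 1; have E0 : 0 <= E by exact: expR_ge0.
pose C1 := 2 * (E * K) + 1.
pose M := \sum_j mnorm (U j).
have M0 : 0 <= M by apply: sumr_ge0 => j _; exact: mnorm_ge0.
have C10 : 0 <= C1 by rewrite /C1; have := mulr_ge0 E0 K0; lra.
pose C2 := M * (E * C1 * K + E * K * ((2 * K * E + 1) * C1)).
have C20 : 0 <= C2.
  rewrite /C2 mulr_ge0// addr_ge0// !mulr_ge0//.
  by rewrite addr_ge0// !mulr_ge0.
exists (E * C1 + C2); first by rewrite addr_ge0// mulr_ge0.
move=> A B p p' x t y r skA skB AK pK p'K geox geoy.
set D := mnorm (A - B) + eucl (p - p').
have D0 : 0 <= D by rewrite addr_ge0 ?mnorm_ge0 ?eucl_ge0.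
have speedx := geodesic_speed skA geox; have boundy := geodesic_bound skB geoy.
case: geox => x0 t0 hx ht; case: geoy => y0 r0 hy hr.
pose w s := 2 *: ((A - B) *m y s) + (p - p').
have yK s : 0 <= s <= 1 -> eucl (y s) <= E * K.
  by move=> s01; rewrite (le_trans (boundy s s01))// ler_wpM2l.
have wD s : 0 <= s <= 1 -> eucl (w s) <= C1 * D.
  move=> s01; apply: (le_trans (euclD _ _)); rewrite euclZ ger0_norm//.
  have h1 := eucl_mulmx (A - B) (y s).
  have h2 := ler_wpM2l (mnorm_ge0 (A - B)) (yK s s01).
  have h3 : 0 <= E * K * eucl (p - p') by rewrite !mulr_ge0 ?eucl_ge0.
  rewrite /C1 /D; have := mnorm_ge0 (A - B); lra.
have dE s : (2 *: (A *m x s) + p) - (2 *: (B *m y s) + p') = 2 *: (A *m (x s - y s)) + w s.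
  by rewrite /w mulmxBr mulmxBl !scalerBr; apply/matrixP => i j; rewrite !mxE; ring.
have hd s : 0 <= s <= 1 -> is_vderive (fun s => x s - y s) s (2 *: (A *m (x s - y s)) + w s).
  by move=> s01; rewrite -dE; exact: (is_vderiveB (hx s s01) (hy s s01)).
have dD s : 0 <= s <= 1 -> eucl (x s - y s) <= E * C1 * D.
  move=> s01; rewrite -mulrA; apply: (skew_gronwall skA _ hd wD) => //.
  by rewrite x0 y0 subrr.
have c01 : 0 <= (1 : R) <= 1 by rewrite ler01 lexx.
split=> [|j]; first by rewrite (le_trans (dD 1 c01))// ler_wpM2r// lerDl.
have hj s : 0 <= s <= 1 -> is_derive s 1 (fun s => t s j 0 - r s j 0)
    (2^-1 * dotv (U j *m x s) (2 *: (A *m x s) + p) -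
     2^-1 * dotv (U j *m y s) (2 *: (B *m y s) + p')).
  by move=> s01; have := is_derive_sub (ht s s01 j) (hr s s01 j); rewrite !mxE.
have := @mean_value_bound R _ _ 0 1 (C2 * D) hj _ 1 0 c01.
rewrite t0 r0 !mxE subrr !subr0 normr1 mulr1 lexx ler01 => H.
apply: (@le_trans _ _ (C2 * D)); last by rewrite ler_wpM2r// lerDr mulr_ge0.
apply: H => // s s01; rewrite -mulrBr normrM ger0_norm ?invr_ge0//.
set vx := 2 *: (A *m x s) + p; set vy := 2 *: (B *m y s) + p'.
have -> : dotv (U j *m x s) vx - dotv (U j *m y s) vy =
    dotv (U j *m (x s - y s)) vx + dotv (U j *m y s) (vx - vy).
  by rewrite mulmxBr dotvBl dotvBr; ring.
have UjM : mnorm (U j) <= M.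
  by rewrite /M (bigD1 j)//= lerDl; apply: sumr_ge0 => i _; exact: mnorm_ge0.
have vxK : eucl vx <= K by rewrite /vx speedx.
have dvD : eucl (vx - vy) <= (2 * K * E + 1) * C1 * D.
  rewrite dE; apply: (le_trans (euclD _ _)); rewrite euclZ ger0_norm//.
  have h1 := eucl_mulmx A (x s - y s).
  have h2 := ler_pM (mnorm_ge0 A) (eucl_ge0 _) AK (dD s s01).
  have := wD s s01; lra.
have b1 : `|dotv (U j *m (x s - y s)) vx| <= M * (E * C1 * D) * K.
  apply: (le_trans (normr_dotv_le _ _)); apply: ler_pM => //; try exact: eucl_ge0.
  by apply: (le_trans (eucl_mulmx _ _)); apply: ler_pM; rewrite ?mnorm_ge0 ?eucl_ge0 ?dD.
have b2 : `|dotv (U j *m y s) (vx - vy)| <= M * (E * K) * ((2 * K * E + 1) * C1 * D).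
  apply: (le_trans (normr_dotv_le _ _)); apply: ler_pM => //; try exact: eucl_ge0.
  by apply: (le_trans (eucl_mulmx _ _)); apply: ler_pM; rewrite ?mnorm_ge0 ?eucl_ge0 ?yK.
have := ler_normD (dotv (U j *m (x s - y s)) vx) (dotv (U j *m y s) (vx - vy)).
set n := `|_ + _| => h.
have : n <= C2 * D by apply: (le_trans h); rewrite /C2; lra.
have : 0 <= n by exact: normr_ge0.
lra.
Qed.

End Geodesics.

(** * Maximizers of the phase function *)

Section Maximizers.
Variables (R : realType) (q m : nat) (U : 'I_m -> 'M[R]_q).
Hypothesis skU : forall j, (U j)^T = - U j.
Implicit Types (tau v : 'cV[R]_m) (X : 'cV[R]_q).
Notation A := (Amat U).
Notation M := (UcotU U).

Lemma AmatD tau v : A (tau + v) = A tau + A v.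
Proof. by rewrite -big_split; apply: eq_bigr => j _; rewrite mxE scalerDl. Qed.

Lemma AmatZ (a : R) tau : A (a *: tau) = a *: A tau.
Proof. by rewrite scaler_sumr; apply: eq_bigr => j _; rewrite mxE scalerA. Qed.

Lemma AmatB tau v : A (tau - v) = A tau - A v.
Proof. by rewrite AmatD -scaleN1r AmatZ scaleN1r. Qed.

Lemma mnorm_Amat_le tau : mnorm (A tau) <= (\sum_j mnorm (U j)) * eucl tau.
Proof.
apply: (le_trans (mnorm_sum _ _)); rewrite mulr_suml; apply: ler_sum => j _.
by rewrite mnormZ mulrC ler_wpM2l ?mnorm_ge0// coord_le_eucl.
Qed.

Lemma Omega_star0 : Omega_star U 0.
Proof.
rewrite /Omega_star /=; apply: le_lt_trans (pi_gt0 R).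
apply: (le_trans (opnorm_le_mnorm _)); apply: (le_trans (mnorm_Amat_le _)).
by rewrite eucl0 mulr0.
Qed.

Lemma opnorm_scale_le (r : R) tau : 0 <= r -> Omega_star U tau -> opnorm (A (r *: tau)) <= r * pi.
Proof.
move=> r0 /ltW tau_pi; rewrite AmatZ (le_trans (opnormZ_le _ _))//.
by rewrite ger0_norm// ler_wpM2l.
Qed.

Lemma Omega_star_scale (r : R) tau : 0 <= r < 1 -> Omega_star U tau -> Omega_star U (r *: tau).
Proof.
move=> /andP[r0 r1] hO; rewrite /Omega_star /=; apply: (le_lt_trans (opnorm_scale_le r0 hO)).
by rewrite gtr_pMl// pi_gt0.
Qed.

Lemma geodesic_to tau X : Omega_star U tau ->
  exists x t, geodesic U (A tau) ((M tau - A tau) *m X) x t /\ x 1 = X.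
Proof.
move=> tau_pi; have skA := Amat_skew skU tau.
have [N [nu [P sp]]] := skew_spectrumP skA.
have [x [t geo]] := geodesic_exists U ((M tau - A tau) *m X) skA.
exists x, t; split => //; rewrite (geodesic_endpoint skA sp geo).
by rewrite /UcotU (sp_matfun sp) mulmxA (flow_mx1_inverse sp)// mul1mx.
Qed.

Lemma geodesic_phi tau X x t : geodesic U (A tau) ((M tau - A tau) *m X) x t -> x 1 = X ->
  dotv ((M tau - A tau) *m X) ((M tau - A tau) *m X) = phi U (X, t 1) tau.
Proof.
move=> geo x1; rewrite (geodesic_energy skU geo) x1 /phi /=; congr (_ + _).
by rewrite mulmxBl !(dotvDl, dotvNl, dotvZl) (dotv_skew_self _ (Amat_skew skU tau)); ring.
Qed.

(** The lower bound tested on the geodesic itself: its squared length |p|^2 is already the value of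
    [phi] at tau. *)
Lemma geodesic_phi_max tau X x t : Omega_star U tau ->
  geodesic U (A tau) ((M tau - A tau) *m X) x t -> x 1 = X ->
  forall tau', Omega_star U tau' -> phi U (X, t 1) tau' <= phi U (X, t 1) tau.
Proof.
move=> tau_pi geo x1 tau' tau'_pi.
have [hor len] := geodesic_horizontal (Amat_skew skU tau) geo.
rewrite x1 in hor; rewrite -(geodesic_phi geo x1) -sqr_eucl.
exact: (phi_le_sqr_length skU hor tau'_pi len).
Qed.

(** The bound is uniform only for rho < pi, since [hcot] tends to minus infinity at pi^2. *)
Lemma UcotU_bounded (rho : R) : 0 <= rho < pi -> exists2 C, 0 <= C &
  forall tau, opnorm (A tau) <= rho -> forall z, eucl (M tau *m z) <= C * eucl z.
Proof.
move=> hrho; have [C C0 hC] := hcot_bounded hrho; exists C => // tau tau_rho z.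
have [N [nu [P sp]]] := skew_spectrumP (Amat_skew skU tau).
apply: eucl_le; first by rewrite mulr_ge0// eucl_ge0.
rewrite /UcotU (sp_matfun sp) -/(spfun P (fun i => hcot (nu i ^+ 2))).
rewrite dotv_trmx (spfun_sym sp) mulmxA (spfunM sp) dotvC dotv_spfun exprMn sqr_eucl.
rewrite -[X in dotv X z](mul1mx z) -(spfun1 sp) dotv_spfun mulr_sumr.
apply: ler_sum => i _; rewrite mul1r ler_wpM2r ?(dotv_proj_ge0 sp)//.
have /andP[nu0 nuA] := sp_mu sp i; have := hC (nu i); rewrite nu0 (le_trans nuA)// => /(_ isT).
by rewrite ler_norml => /andP[]; nra.
Qed.

Lemma inverse_velocity tau X x t p : Omega_star U tau ->
  geodesic U (A tau) p x t -> x 1 = X -> p = (M tau - A tau) *m X.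
Proof.
move=> tau_pi geo <-; have skA := Amat_skew skU tau.
have [N [nu [P sp]]] := skew_spectrumP skA.
rewrite (geodesic_endpoint skA sp geo) /UcotU (sp_matfun sp) mulmxA.
by rewrite (mulmx1C (flow_mx1_inverse sp _)) ?mul1mx.
Qed.

(* If E is the endpoint map p |-> x(1) at tau0 and E' the one at a nearby tau',
   then E'^-1 X - E^-1 X = E'^-1 (E - E') E^-1 X. *)
Lemma vertical_endpoint_continuous tau0 v X x0 t0 : Omega_star U tau0 ->
  geodesic U (A tau0) ((M tau0 - A tau0) *m X) x0 t0 -> x0 1 = X ->
  exists C d : R, 0 < d /\ forall e, 0 < e < d -> Omega_star U (tau0 + e *: v) /\
    forall x t, geodesic U (A (tau0 + e *: v))
        ((M (tau0 + e *: v) - A (tau0 + e *: v)) *m X) x t -> x 1 = X ->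
      `|dotv (t0 1 - t 1) v| <= C * e.
Proof.
move=> tau_pi geo0 x01; have a0 := opnorm_ge0 (A tau0).
have api : opnorm (A tau0) < pi := tau_pi.
pose rho : R := (opnorm (A tau0) + pi) / 2.
have rho_pi : 0 <= rho < pi by rewrite /rho; lra.
pose a1 := opnorm (A v); have a10 : 0 <= a1 by exact: opnorm_ge0.
have [C1 C10 hC1] := UcotU_bounded rho_pi; pose C2 := C1 + rho.
have C20 : 0 <= C2 by rewrite /C2; lra.
have hC2 tau z : opnorm (A tau) <= rho -> eucl ((M tau - A tau) *m z) <= C2 * eucl z.
  move=> hr; rewrite mulmxBl (le_trans (euclB _ _))// mulrDl lerD ?hC1//.
  by rewrite (le_trans (eucl_le_opnorm _ _))// ler_wpM2r ?eucl_ge0.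
pose n0 := mnorm (A tau0); pose n1 := mnorm (A v).
have [n00 n10] : 0 <= n0 /\ 0 <= n1 by rewrite !mnorm_ge0.
have C2X0 : 0 <= C2 * eucl X by rewrite mulr_ge0// eucl_ge0.
pose K := C2 * eucl X + n0.
have K0 : 0 <= K by rewrite /K addr_ge0.
have [C3 C30 stab] := geodesic_stability U K0.
(* For e < d the perturbation e A(v) has norm less than half the gap between |A(tau0)| and pi, so
   |A(tau)| stays below the midpoint rho. The summand 1 avoids dividing by zero. *)
pose d : R := (pi - opnorm (A tau0)) / 2 / (a1 + 1).
have d0 : 0 < d by rewrite /d !divr_gt0//; lra.
exists (C3 * (n1 + C2 * (C3 * n1)) * \sum_j `|v j 0|), d; split => // e /andP[e0 ed].
set tau := tau0 + e *: v.
have tau_rho : opnorm (A tau) <= rho.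
  rewrite /tau AmatD AmatZ (le_trans (opnormD _ _))//.
  have := opnormZ_le e (A v); rewrite ger0_norm ?(ltW e0)// -/a1 => h1.
  have : e * (a1 + 1) < (pi - opnorm (A tau0)) / 2 by rewrite -ltr_pdivlMr//; lra.
  rewrite /rho; lra.
have tau_O : Omega_star U tau by rewrite /Omega_star /=; lra.
split=> // x t geo x1; set p := _ *m X in geo; set p0 := _ *m X in geo0.
(* The auxiliary geodesic y takes its parameter from x and its initial velocity from x0. Stability
   bounds y(1) - X, and p0 - p = (M(tau) - A(tau)) (y(1) - X). *)
have [y [r geoy]] := geodesic_exists U p0 (Amat_skew skU tau).
have dA : mnorm (A tau0 - A tau) = n1 * e.
  by rewrite -AmatB /tau opprD addNKr -scaleNr AmatZ mnormZ normrN gtr0_norm// mulrC.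
have tau0_rho : opnorm (A tau0) <= rho by rewrite /rho; lra.
have p0K : eucl p0 <= K by rewrite (le_trans (hC2 _ X tau0_rho))// /K lerDl.
have pK : eucl p <= K by rewrite (le_trans (hC2 _ X tau_rho))// /K lerDl.
have n0K : mnorm (A tau0) <= K by rewrite /K lerDr.
have [h1 _] := stab _ _ _ _ _ _ _ _ (Amat_skew skU tau0) (Amat_skew skU tau) n0K p0K p0K geo0 geoy.
rewrite x01 subrr eucl0 addr0 dA in h1.
have dp : eucl (p0 - p) <= C2 * (C3 * (n1 * e)).
  rewrite -opprB euclN {1}(inverse_velocity tau_O geoy erefl) /p -mulmxBr.
  by rewrite (le_trans (hC2 _ _ tau_rho))// ler_wpM2l.
have [_ h2] := stab _ _ _ _ _ _ _ _ (Amat_skew skU tau0) (Amat_skew skU tau) n0K p0K pK geo0 geo.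
rewrite /dotv (le_trans (ler_norm_sum _ _ _))// mulrAC mulr_sumr.
apply: ler_sum => j _; rewrite normrM ler_wpM2r// !mxE (le_trans (h2 j))// -mulrA ler_wpM2l// dA.
by move: dp; rewrite !mulrA mulrDl; lra.
Qed.

(** Put v = T - t(1) and tau = tau0 + e v, and let r be the vertical part of the geodesic to X at
    tau. Adding the maximality of tau0 for T to the maximality of tau for r(1) cancels the quadratic
    forms and leaves <T - r(1), v> <= 0; since r(1) is within O(e) of t(1) along v, |v|^2 <= C e. *)
Lemma vertical_endpoint_of_max tau0 X T x t : Omega_star U tau0 ->
  (forall tau, Omega_star U tau -> phi U (X, T) tau <= phi U (X, T) tau0) ->
  geodesic U (A tau0) ((M tau0 - A tau0) *m X) x t -> x 1 = X -> t 1 = T.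
Proof.
move=> tau_pi hmax geo x1; have [v vE] : exists v, v = T - t 1 by exists (T - t 1).
have [C [d [d0 h]]] := vertical_endpoint_continuous v tau_pi geo x1.
suff : dotv v v <= 0.
  move=> v0; have /dotv_eq0/eqP : dotv v v = 0 by apply/eqP; rewrite eq_le v0 dotv_ge0.
  by rewrite vE subr_eq0 => /eqP.
have step e : 0 < e < d -> dotv v v <= C * e.
  move=> e0d; have [tau_O he] := h e e0d.
  have [y [r [geoy y1]]] := geodesic_to X tau_O.
  have h1 := geodesic_phi_max tau_O geoy y1 tau_pi.
  have h2 := hmax _ tau_O; have h3 := he _ _ geoy y1.
  move: h1 h2; rewrite /phi /= !dotvDr !dotvZr => h1 h2.
  have h4 : e * (dotv T v - dotv (r 1) v) <= 0 by lra.
  have {}h4 : dotv T v <= dotv (r 1) v.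
    by move: h4; rewrite pmulr_rle0 ?subr_le0//; case/andP: e0d.
  move: h3; rewrite ler_norml dotvBl => /andP[h3 _].
  have -> : dotv v v = dotv T v - dotv (t 1) v by rewrite -dotvBl -vE.
  lra.
rewrite leNgt; apply/negP => v0.
have c0 : 0 < `|C| + 1 by have := normr_ge0 C; lra.
pose e := Num.min (d / 2) (dotv v v / (`|C| + 1) / 2).
have e0 : 0 < e by rewrite lt_min !divr_gt0.
have ed : e < d by rewrite gt_min; apply/orP; left; lra.
have := step e; rewrite e0 ed => /(_ isT).
have : e * (`|C| + 1) <= dotv v v / 2.
  by rewrite -ler_pdivlMr// mulrAC ge_min lexx orbT.
have := ler_norm C; nra.
Qed.

Lemma UcotU0 X : dotv (M 0 *m X) X = dotv X X.
Proof.
have [N [nu [P sp]]] := skew_spectrumP (Amat_skew skU 0).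
rewrite /UcotU (sp_matfun sp) -/(spfun P (fun i => hcot (nu i ^+ 2))).
rewrite (_ : (fun i => _) = fun=> 1) ?(spfun1 sp) ?mul1mx//; apply/funext => i.
have /andP[nu0 nuA] := sp_mu sp i.
have := le_trans nuA (le_trans (opnorm_le_mnorm _) (mnorm_Amat_le 0)).
rewrite eucl0 mulr0 => nu0'; have -> : nu i = 0 by apply/eqP; rewrite eq_le nu0 nu0'.
by rewrite /hcot expr0n eqxx.
Qed.

Lemma UcotU_le tau X : Omega_star U tau -> dotv (M tau *m X) X <= dotv X X.
Proof.
move=> tau_pi; have [N [nu [P sp]]] := skew_spectrumP (Amat_skew skU tau).
rewrite /UcotU (sp_matfun sp) -/(spfun P (fun i => hcot (nu i ^+ 2))) dotv_spfun.
rewrite -[X in _ <= dotv X _](mul1mx X) -(spfun1 sp) dotv_spfun; apply: ler_sum => i _.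
rewrite ler_wpM2r ?(dotv_proj_ge0 sp)// hcot_le1//.
by have /andP[-> /le_lt_trans->] := sp_mu sp i.
Qed.

(* The vertical endpoint of the geodesic with parameter r tau is a
   supergradient, so tau |-> <M(tau) X, X> is concave. *)
Lemma phi_scale (g : Gpt R q m) (r : R) tau : 0 <= r < 1 -> Omega_star U tau ->
  r * phi U g tau <= phi U g (r *: tau).
Proof.
move=> /andP[r0 r1] tau_pi; case: g => X T; pose s := r *: tau.
have s_pi : Omega_star U s by apply: Omega_star_scale; rewrite ?r0.
have [x [t [geo x1]]] := geodesic_to X s_pi.
(* The supergradient inequality at s = r tau is used at tau with weight r and at 0 with weight 1 -
   r, where phi(g; 0) = |X|^2 >= 0. *)
have h1 := geodesic_phi_max s_pi geo x1 tau_pi.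
have h2 := geodesic_phi_max s_pi geo x1 Omega_star0.
move: h1 h2; rewrite /phi /= UcotU0 -/s dotv0 /s !dotvZr => h1 h2.
have h3 := ler_wpM2l r0 h1.
have h4 : 0 <= (1 - r) * (dotv (M (r *: tau) *m X) X + 4 * (r * dotv (t 1) tau)).
  by rewrite mulr_ge0//; [lra|have := dotv_ge0 X; lra].
lra.
Qed.

Lemma phi_lipschitz (rho K : R) : 0 <= rho < pi -> 0 <= K -> exists2 C, 0 <= C &
  forall tau (g g' : Gpt R q m), opnorm (A tau) <= rho -> eucl tau <= K ->
    eucl g.1 <= K -> eucl g'.1 <= K ->
    phi U g tau - phi U g' tau <= C * (eucl (g.1 - g'.1) + eucl (g.2 - g'.2)).
Proof.
move=> hrho K0; have [C C0 hC] := UcotU_bounded hrho.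
have CK0 : 0 <= C * K by rewrite mulr_ge0.
exists (2 * (C * K) + 4 * K) => [|tau [X T] [Y S] /= tau_rho tauK XK YK]; first lra.
rewrite /phi /=.
have -> : dotv (M tau *m X) X + 4 * dotv T tau -
    (dotv (M tau *m Y) Y + 4 * dotv S tau) =
   dotv (M tau *m (X - Y)) X + dotv (M tau *m Y) (X - Y) + 4 * dotv (T - S) tau.
  by rewrite mulmxBr !dotvBl !dotvBr; ring.
have d1 : dotv (M tau *m (X - Y)) X <= C * eucl (X - Y) * K.
  by rewrite (le_trans (dotv_le _ _))//; apply: ler_pM; rewrite ?eucl_ge0 ?hC.
have d2 : dotv (M tau *m Y) (X - Y) <= C * K * eucl (X - Y).
  rewrite (le_trans (dotv_le _ _))// ler_wpM2r ?eucl_ge0// (le_trans (hC _ tau_rho Y))//.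
  by rewrite ler_wpM2l.
have d3 : dotv (T - S) tau <= eucl (T - S) * K.
  by rewrite (le_trans (dotv_le _ _))// ler_wpM2l ?eucl_ge0.
have := mulr_ge0 K0 (eucl_ge0 (X - Y)); have := mulr_ge0 CK0 (eucl_ge0 (T - S)).
lra.
Qed.

(** Linear independence makes tau |-> A(tau) injective, and a pseudo-inverse of its matrix V
    recovers tau linearly from the entries of A(tau). Consequently [Omega_star] is bounded. *)
Lemma eucl_le_opnorm_Amat :
  (forall c : 'I_m -> R, \sum_(j < m) c j *: U j = 0 -> forall j, c j = 0) ->
  exists2 C, 0 <= C & forall tau, eucl tau <= C * opnorm (A tau).
Proof.
move=> indep; pose V : 'M[R]_(m, q * q) := \matrix_j mxvec (U j).
have VE tau : tau^T *m V = mxvec (A tau).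
  rewrite mulmx_sum_row linear_sum; apply: eq_bigr => j _.
  by rewrite rowK linearZ /= mxE.
have Vfree : row_free V.
  apply: inj_row_free => w wV; have := VE w^T; rewrite trmxK wV => /esym/eqP.
  rewrite mxvec_eq0 => /eqP/indep h; apply/matrixP => i j; rewrite (ord1 i) mxE.
  by have := h j; rewrite mxE.
pose W := (pinvmx V)^T.
have WE tau : tau = W *m (mxvec (A tau))^T.
  by rewrite -trmx_mul -VE (mulmxKp Vfree) trmxK.
exists (mnorm W * (q * q)%:R) => [|tau]; first by rewrite mulr_ge0 ?mnorm_ge0.
rewrite {1}(WE tau) (le_trans (eucl_mulmx _ _))// -mulrA ler_wpM2l ?mnorm_ge0//.
apply: (le_trans (eucl_le_sum _)).
apply: (@le_trans _ _ (\sum_(k < q * q) opnorm (A tau))); last first.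
  by rewrite sumr_const card_ord mulr_natl.
apply: ler_sum => k _; rewrite mxE; case/mxvec_indexP: k => i j.
by rewrite mxvecE entry_le_opnorm.
Qed.

End Maximizers.

(** * Passage to the closure *)

Section Compactness.
Variable R : realType.

(** A filter version of extracting a convergent subsequence: the sets [D e] shrink with e, generate
    a proper filter, and [D 1] lies in a compact box. *)
Lemma cluster_point_rV n (D : R -> set 'rV[R]_n) (K : R) :
  (forall e, 0 < e -> D e !=set0) -> (forall e e', e <= e' -> D e `<=` D e') ->
  (forall w, D 1 w -> forall i, `|w 0 i| <= K) ->
  exists w : 'rV[R]_n, forall e, 0 < e -> exists2 w', D e w' &
    forall i : 'I_n, `|w 0 i - w' 0 i| < e.
Proof.
move=> D0 Dmono DK; pose F := filter_from [set e : R | 0 < e] D.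
have FF : Filter F.
  apply: filter_from_filter; first by exists 1 => /=.
  move=> e e' /= e0 e'0; exists (Num.min e e'); first by rewrite /= lt_min e0.
  by move=> w hw; split; apply: Dmono hw; rewrite ge_min lexx ?orbT.
have FP : ProperFilter F by apply: filter_from_proper.
have cK := @rV_compact R n (fun=> [set` `[- K, K]]) (fun=> @segment_compact R (- K) K).
have [|w [_ wF]] := cK F FP.
  by exists 1 => //= w /DK h i; rewrite /= in_itv /= -ler_norml.
exists w => e e0; have [|w' [Dw' bw']] := wF (D e) (ball w e) _ (nbhsx_ballx w e e0).
  by exists e.
by exists w' => // i; have := bw'.2 0 i.
Qed.

Lemma eucl_le_coord n (u : 'cV[R]_n) (e : R) :
  (forall i, `|u i 0| <= e) -> eucl u <= n%:R * e.
Proof.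
move=> h; apply: (le_trans (eucl_le_sum _)).
apply: (@le_trans _ _ (\sum_(i < n) e)); first exact: ler_sum.
by rewrite sumr_const card_ord mulr_natl.
Qed.

Lemma le0_of_small_bound (a C : R) : (forall e, 0 < e -> e <= 1 -> a <= C * e) -> a <= 0.
Proof.
move=> h; rewrite leNgt; apply/negP => a0.
have c0 : 0 < `|C| + 1 by have := normr_ge0 C; lra.
pose e := Num.min 1 (a / (`|C| + 1) / 2).
have e0 : 0 < e by rewrite lt_min ltr01 !divr_gt0.
have e1 : e <= 1 by rewrite ge_min lexx.
have := h e e0 e1; have : e * (`|C| + 1) <= a / 2.
  by rewrite -ler_pdivlMr// mulrAC ge_min lexx orbT.
have := ler_norm C; nra.
Qed.

End Compactness.

Section Closure.
Variables (R : realType) (q m : nat) (U : 'I_m -> 'M[R]_q).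
Hypothesis skU : forall j, (U j)^T = - U j.
Hypothesis indepU : forall c : 'I_m -> R, \sum_(j < m) c j *: U j = 0 -> forall j, c j = 0.
Notation A := (Amat U).

(** The initial velocity is recorded in its own right, since it has limits where its formula through
    [UcotU] does not. *)
Definition extremal (g : Gpt R q m) (tau : 'cV[R]_m) (p : 'cV[R]_q) : Prop :=
  Omega_star U tau /\
  exists x t, [/\ geodesic U (A tau) p x t, x 1 = g.1, t 1 = g.2 & dotv p p = phi U g tau].

Lemma Mtilde_extremal g : Mtilde U g -> exists tau p, extremal g tau p.
Proof.
case: g => X T [tau tau_pi hmax].
have [x [t [geo x1]]] := geodesic_to skU X tau_pi.
have t1 := vertical_endpoint_of_max skU tau_pi hmax geo x1.
exists tau, ((UcotU U tau - A tau) *m X); split => //; exists x, t; split => //.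
by rewrite -t1; exact: (geodesic_phi skU geo).
Qed.

(** The pair (tau, p) is packed into one row vector to obtain a simultaneous cluster point. The
    limiting tau may lie on the boundary of [Omega_star]. *)
Lemma closure_extremal g : closure (Mtilde U) g ->
  exists tau p (C : R), 0 <= C /\ forall e, 0 < e -> e <= 1 ->
    exists g' tau' p', [/\ extremal g' tau' p', eucl tau' <= C, eucl p' <= C &
      eucl (g.1 - g'.1) + eucl (g.2 - g'.2) + eucl (tau - tau') + eucl (p - p') <= C * e].
Proof.
move=> clg; have [C1 C10 hC1] := eucl_le_opnorm_Amat indepU.
pose near (e : R) (g' : Gpt R q m) :=
  (forall i, `|g.1 i 0 - g'.1 i 0| < e) /\ (forall j, `|g.2 j 0 - g'.2 j 0| < e).
have near_eucl e g' : near e g' ->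
    eucl (g.1 - g'.1) <= q%:R * e /\ eucl (g.2 - g'.2) <= m%:R * e.
  by move=> [h1 h2]; split; apply: eucl_le_coord => i; rewrite !mxE ltW.
pose D (e : R) : set 'rV[R]_(m + q) := [set w | exists g' tau p,
  [/\ near e g', extremal g' tau p & w = row_mx tau^T p^T]].
have tauK g' tau p : extremal g' tau p -> eucl tau <= C1 * pi.
  by move=> [/ltW tau_pi _]; rewrite (le_trans (hC1 tau))// ler_wpM2l.
have C1pi : 0 <= C1 * pi by rewrite mulr_ge0 ?pi_ge0.
(* An upper bound of |X'|^2 + 4 |T'| |tau|, hence of |p|^2, over the points (X', T') within 1 of g
   in each coordinate. *)
pose K2 := (eucl g.1 + q%:R) ^+ 2 + 4 * ((eucl g.2 + m%:R) * (C1 * pi)).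
have K20 : 0 <= K2.
  by rewrite addr_ge0 ?sqr_ge0// mulr_ge0// mulr_ge0// addr_ge0// eucl_ge0.
have pK g' tau p : near 1 g' -> extremal g' tau p -> eucl p <= K2 + 1.
  move=> ng ex; have tK := tauK _ _ _ ex; case: ex => tau_pi [x [t [_ _ _ pp]]].
  have [] := near_eucl _ _ ng; rewrite !mulr1 => n1 n2.
  have g1 : eucl g'.1 <= eucl g.1 + q%:R.
    have := euclB g.1 (g.1 - g'.1); rewrite opprB addrC subrK; lra.
  have g2 : eucl g'.2 <= eucl g.2 + m%:R.
    have := euclB g.2 (g.2 - g'.2); rewrite opprB addrC subrK; lra.
  have pK2 : eucl p ^+ 2 <= K2.
    rewrite sqr_eucl pp /phi /K2 lerD//.
      apply: (le_trans (UcotU_le skU _ tau_pi)).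
      by rewrite -sqr_eucl lerXn2r ?nnegrE ?addr_ge0 ?eucl_ge0.
    rewrite ler_wpM2l// (le_trans (dotv_le _ _))//.
    by apply: ler_pM; rewrite ?eucl_ge0.
  have := sqr_ge0 (eucl p - 1); nra.
have [w hw] : exists w : 'rV[R]_(m + q), forall e, 0 < e ->
    exists2 w', D e w' & forall i : 'I_(m + q), `|w 0 i - w' 0 i| < e.
  apply: (@cluster_point_rV _ _ D (C1 * pi + (K2 + 1))).
  - move=> e e0; have [g' [gM [b1 b2]]] := clg (ball g e) (nbhsx_ballx g e e0).
    have [tau [p ex]] := Mtilde_extremal gM; exists (row_mx tau^T p^T), g', tau, p.
    by split => //; split => i; [have := b1.2 i 0|have := b2.2 i 0].
  - move=> e e' ee' w [g' [tau [p [[n1 n2] ex wE]]]]; exists g', tau, p; split => //.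
    by split => i; [exact: lt_le_trans (n1 i) ee'|exact: lt_le_trans (n2 i) ee'].
  - move=> w [g' [tau [p [ng ex ->]]]] i; have tK := tauK _ _ _ ex; have pK' := pK _ _ _ ng ex.
    case: (splitP i) => k ik.
      rewrite (_ : i = lshift q k); last exact: val_inj.
      by rewrite row_mxEl mxE; have := coord_le_eucl tau k; lra.
    rewrite (_ : i = rshift m k); last exact: val_inj.
    by rewrite row_mxEr mxE; have := coord_le_eucl p k; lra.
(* The first summands bound |tau'| and |p'|. The last one adds up the four distances, each at most q
   e or m e. *)
pose C := C1 * pi + (K2 + 1) + 2 * (q%:R + m%:R).
have qm0 : 0 <= q%:R + m%:R :> R by rewrite addr_ge0.
exists (lsubmx w)^T, (rsubmx w)^T, C; split=> [|e e0 e1]; first by rewrite /C; lra.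
have [w' [g' [tau [p [ng ex wE]]]] ww'] := hw e e0.
have ng1 : near 1 g'.
  by case: ng => n1 n2; split => i; [exact: lt_le_trans (n1 i) e1|exact: lt_le_trans (n2 i) e1].
exists g', tau, p; split => //.
- by have := tauK _ _ _ ex; rewrite /C; lra.
- by have := pK _ _ _ ng1 ex; rewrite /C; lra.
have [h1 h2] := near_eucl _ _ ng.
have h3 : eucl ((lsubmx w)^T - tau) <= m%:R * e.
  apply: eucl_le_coord => i; have := ww' (lshift q i); rewrite wE row_mxEl !mxE; exact: ltW.
have h4 : eucl ((rsubmx w)^T - p) <= q%:R * e.
  apply: eucl_le_coord => i; have := ww' (rshift m i); rewrite wE row_mxEr !mxE; exact: ltW.
have : 0 <= (C1 * pi + (K2 + 1)) * e by rewrite mulr_ge0 ?(ltW e0)//; lra.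
rewrite /C; lra.
Qed.

(** The energy is compared with an arbitrary upper bound S because the theorem instantiates S twice,
    with the squared length of a competitor and with the supremum. *)
Lemma closure_geodesic g : closure (Mtilde U) g ->
  exists tau p x t, [/\ geodesic U (A tau) p x t, x 1 = g.1, t 1 = g.2 &
    forall S : R, (forall tau', Omega_star U tau' -> phi U g tau' <= S) -> dotv p p <= S].
Proof.
move=> /closure_extremal[tau [p [C [C0 hC]]]].
have skA := Amat_skew skU tau; have [x [t geo]] := geodesic_exists U p skA.
have [N N0 AN] : exists2 N : R, 0 <= N & forall v, mnorm (A v) <= N * eucl v.
  exists (\sum_j mnorm (U j)); last exact: mnorm_Amat_le.
  by apply: sumr_ge0 => j _; exact: mnorm_ge0.
have [K [K0 AK pK CK gK]] : exists K : R,
    [/\ 0 <= K, mnorm (A tau) <= K, eucl p <= K, C <= K & eucl g.1 + C <= K].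
  exists (mnorm (A tau) + eucl p + C + eucl g.1).
  have := mnorm_ge0 (A tau); have := eucl_ge0 p; have := eucl_ge0 g.1.
  by split; lra.
have [C1 C10 stab] := geodesic_stability U K0.
have near e : 0 < e -> e <= 1 -> exists g' tau' p', [/\ extremal g' tau' p',
    eucl tau' <= K, eucl p' <= K, eucl g'.1 <= K &
    [/\ eucl (g.1 - g'.1) + eucl (g.2 - g'.2) <= C * e, eucl (p - p') <= C * e,
      eucl (x 1 - g'.1) <= C1 * (N * C + C) * e &
      forall j, `|t 1 j 0 - g'.2 j 0| <= C1 * (N * C + C) * e]].
  move=> e0 e1; have [g' [tau' [p' [ex tC p'C h]]]] := hC e e0 e1.
  have [u1 u2 u3 u4] := And4 (eucl_ge0 (g.1 - g'.1)) (eucl_ge0 (g.2 - g'.2))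
    (eucl_ge0 (tau - tau')) (eucl_ge0 (p - p')).
  have Ce : C * e <= C by rewrite ler_piMr.
  have [h1 h2 h3 h4] : [/\ eucl (g.1 - g'.1) <= C * e,
      eucl (g.1 - g'.1) + eucl (g.2 - g'.2) <= C * e,
      eucl (tau - tau') <= C * e & eucl (p - p') <= C * e].
    by clear - u1 u2 u3 u4 h; split; lra.
  have p'K : eucl p' <= K by exact: le_trans CK.
  have tK : eucl tau' <= K by exact: le_trans CK.
  have gK' : eucl g'.1 <= K.
    apply: le_trans gK; have := euclB g.1 (g.1 - g'.1).
    rewrite opprB addrC subrK => /le_trans; apply.
    by rewrite lerD2l (le_trans h1).
  have [_ [y [r [geoy y1 r1 _]]]] := ex.
  have [s1 s2] := stab _ _ _ _ _ _ _ _ skA (Amat_skew skU tau') AK pK p'K geo geoy.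
  have dA : mnorm (A tau - A tau') <= N * (C * e).
    by rewrite -AmatB (le_trans (AN _))// ler_wpM2l.
  have bd : C1 * (mnorm (A tau - A tau') + eucl (p - p')) <= C1 * (N * C + C) * e.
    by rewrite -mulrA ler_wpM2l// mulrDl -mulrA lerD.
  exists g', tau', p'; split => //; split => //; first by rewrite -y1 (le_trans s1).
  by move=> j; rewrite -r1 (le_trans (s2 j)).
have x1 : x 1 = g.1.
  apply/eqP; rewrite -subr_eq0; apply/eqP/eucl_eq0/eqP; rewrite eq_le eucl_ge0 andbT.
  apply: (@le0_of_small_bound _ _ (C1 * (N * C + C) + C)) => e e0 e1.
  have [g' [tau' [p' [_ _ _ _ [h1 _ h2 _]]]]] := near e e0 e1.
  have := euclB (x 1 - g'.1) (g.1 - g'.1); rewrite opprB addrA subrK.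
  have := eucl_ge0 (g.2 - g'.2); lra.
have t1 : t 1 = g.2.
  apply/matrixP => j k; rewrite (ord1 k); apply/eqP; rewrite -subr_eq0 -normr_le0.
  apply: (@le0_of_small_bound _ _ (C1 * (N * C + C) + C)) => e e0 e1.
  have [g' [tau' [p' [_ _ _ _ [h1 _ _ h2]]]]] := near e e0 e1.
  have := coord_le_eucl (g.2 - g'.2) j; rewrite !mxE => h3.
  have := ler_normB (t 1 j 0 - g'.2 j 0) (g.2 j 0 - g'.2 j 0); rewrite opprB addrA subrK.
  have := eucl_ge0 (g.1 - g'.1); have := h2 j; lra.
exists tau, p, x, t; split => // S hS.
have S0 : 0 <= S.
  have := hS 0 (Omega_star0 U); rewrite /phi UcotU0// dotv0 mulr0 addr0.
  by apply: le_trans; exact: dotv_ge0.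
suff main r : 0 <= r < 1 -> r * dotv p p <= S.
  apply/ler_addgt0Pr => e e0.
  have c0 : 0 < dotv p p + e by have := dotv_ge0 p; lra.
  (* For this r the product r |p|^2 differs from |p|^2 by at most e. *)
  have := main (1 - e / (dotv p p + e)).
  rewrite lerBrDr add0r ler_pdivrMr// mul1r lerDr dotv_ge0 ltrBlDr ltrDl divr_gt0//= => /(_ isT).
  rewrite mulrBl mul1r => h; have : e / (dotv p p + e) * dotv p p <= e.
    by rewrite mulrAC ler_pdivrMr// ler_wpM2l ?(ltW e0)// lerDl ltW.
  lra.
move=> /andP[r0 r1]; have p_pi := pi_gt0 R.
have rho : 0 <= r * pi < pi by rewrite mulr_ge0 ?(ltW p_pi)//= gtr_pMl.
(* Since |A(r tau')| <= r pi < pi, [phi] is Lipschitz in g uniformly at r tau'. Hence r |p'|^2 = r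
   phi(g'; tau') <= phi(g'; r tau') <= phi(g; r tau') + O(e) <= S + O(e). *)
have [C2 C20 lip] := phi_lipschitz skU rho K0.
rewrite -subr_le0; apply: (@le0_of_small_bound _ _ (C2 * C + 2 * K * C)) => e e0 e1.
have [g' [tau' [p' [[tau'_pi [_ [_ [_ _ _ pp]]]] tK p'K g'K [h1 h2 _ _]]]]] := near e e0 e1.
have r01 : 0 <= r < 1 by rewrite r0.
have b1 := phi_scale skU g' r01 tau'_pi.
have b2 := hS _ (Omega_star_scale r01 tau'_pi).
have b3 : phi U g' (r *: tau') - phi U g (r *: tau') <= C2 * (C * e).
  apply: (le_trans (lip _ g' g _ _ _ _)) => //.
  - exact: opnorm_scale_le.
  - by rewrite euclZ ger0_norm// (le_trans _ tK)// ler_piMl ?eucl_ge0// ltW.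
  - by apply: le_trans gK; rewrite lerDl.
  - by rewrite -(opprB g.1) -(opprB g.2) !euclN ler_wpM2l.
have b4 : dotv p p - dotv p' p' <= 2 * K * (C * e).
  have -> : dotv p p - dotv p' p' = dotv (p - p') (p + p').
    by rewrite dotvBl !dotvDr (dotvC p'); ring.
  rewrite (le_trans (dotv_le _ _))// mulrC; apply: ler_pM; rewrite ?eucl_ge0//.
  by rewrite (le_trans (euclD _ _))// mulrDl mul1r lerD.
rewrite -pp in b1.
have b5 : r * (dotv p p - dotv p' p') <= 2 * K * (C * e).
  have [d0|/ltW d0] := leP 0 (dotv p p - dotv p' p').
    by apply: le_trans b4; rewrite ler_piMl// ltW.
  apply: (@le_trans _ _ 0); first by rewrite mulr_ge0_le0.
  by rewrite !mulr_ge0// ltW.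
clear - b1 b2 b3 b5; lra.
Qed.

End Closure.

Theorem theorem2p9 (R : realType) (q m : nat) (U : 'I_m -> 'M[R]_q) :
  (0 < q)%N -> (0 < m)%N ->
  (forall j, (U j)^T = - U j) ->
  (forall c : 'I_m -> R, \sum_(j < m) c j *: U j = 0 -> forall j, c j = 0) ->
  forall g : Gpt R q m, closure (Mtilde U) g ->
  (ccdist U g * ccdist U g =
     ereal_sup [set (phi U g tau)%:E | tau in Omega_star U])%E.
Proof.
move=> _ _ skU indepU [X T] clg.
have [tau [p [x [t [geo x1 t1 hp]]]]] := closure_geodesic skU indepU clg.
rewrite /= in x1 t1.
have [hor len] := geodesic_horizontal (Amat_skew skU tau) geo; rewrite x1 t1 in hor.
have phi_le tau' : Omega_star U tau' -> phi U (X, T) tau' <= eucl p ^+ 2.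
  by move=> tau'_pi; exact: (phi_le_sqr_length skU hor tau'_pi len).
have -> : ccdist U (X, T) = (eucl p)%:E.
  apply/eqP; rewrite eq_le; apply/andP; split.
    by apply: ereal_inf_lbound; exists x, t; split.
  apply: le_ereal_inf_tmp => _ [y [r [hory ->]]].
  have l0 : (0 <= \int[@lebesgue_measure R]_(s in `[0%R, 1%R]) (eucl (dervec y s))%:E)%E.
    by apply: integral_ge0 => s _; rewrite lee_fin eucl_ge0.
  case E: (\int[_]_(s in _) _)%E l0 => [l| |] l0 //; last by rewrite leey.
  rewrite !lee_fin in l0 *.
  (* The lower bound along the competitor makes l^2 an upper bound of [phi], which [hp] turns into
     minimality. *)
  have : dotv p p <= l ^+ 2.
    by apply: hp => tau' tau'_pi; exact: (phi_le_sqr_length skU hory tau'_pi E).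
  by rewrite -sqr_eucl ler_pXn2r// nnegrE eucl_ge0.
rewrite -EFinM -expr2; apply/eqP; rewrite eq_le; apply/andP; split; last first.
  by apply: ge_ereal_sup => _ [tau' tau'_pi <-]; rewrite lee_fin phi_le.
set s := ereal_sup _.
have ubs tau' : Omega_star U tau' -> ((phi U (X, T) tau')%:E <= s)%E.
  by move=> tau'_pi; apply: ereal_sup_ubound; exists tau'.
(* The supremum is not minus infinity, as 0 lies in [Omega_star]. *)
case: s ubs => [s| |] ubs; last 2 first.
- by rewrite leey.
- by have := ubs 0 (Omega_star0 U).
rewrite lee_fin sqr_eucl; apply: hp => tau' tau'_pi.
by rewrite -lee_fin ubs.
Qed.
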